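(* Let $0<\alpha\leq1$ and let $f(z)=z+a_2z^2+a_3z^3+\cdots$ belong to the class $\mathcal{G}(\alpha)$. Then $$|H_2(2)|\leq\frac{\alpha^2}{144}\left(\frac{17}{4}-\frac{\alpha}{4+\alpha^2}\right).$$
   Context: Let $\mathbb{D}=\{z\in\mathbb{C}:|z|<1\}$ and let $\mathcal{A}$ be the family of all functions $f$ analytic in $\mathbb{D}$ with $f(0)=0$ and $f'(0)=1$, so that $f(z)=z+a_2z^2+a_3z^3+\cdots$ in $\mathbb{D}$. For $f\in\mathcal{A}$ the second Hankel determinant is $H_2(2)=a_2a_4-a_3^2$. For $0<\alpha\leq1$, the class $\mathcal{G}(\alpha)$ consists of all $f\in\mathcal{A}$ such that $\operatorname{Re}\left[1+\frac{zf''(z)}{f'(z)}\right]<1+\frac12\alpha$ for all $z\in\mathbb{D}$ (here the quotient $zf''(z)/f'(z)$ is understood to be analytic in $\mathbb{D}$, i.e. $f'(z)\neq0$ in $\mathbb{D}$). *)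

(* Defs.v *)
(* Stdlib reals and Coquelicot. *)
From Stdlib Require Import Reals.
From Coquelicot Require Import Coquelicot.

Open Scope R_scope.

Definition in_disk (z : C) : Prop := Cmod z < 1.

(* The structure arguments are explicit because C also carries a real normed
   module structure. *)
Definition is_Cpseries (a : nat -> C) (z l : C) : Prop :=
  @is_pseries C_AbsRing C_NormedModule a z l.

Definition analytic_in_disk (f : C -> C) : Prop :=
  forall z0 : C, in_disk z0 ->
    exists (b : nat -> C) (r : R), 0 < r /\
      forall h : C, Cmod h < r -> is_Cpseries b h (f (z0 + h)%C).

(* Functions are total on C, but only their values on the unit disk matter: the
   disk is open and derivatives are local.  C_derive is a total operator that
   agrees with the complex derivative wherever the latter exists, which is the
   case at every point of the disk for an analytic function and its
   derivatives. *)
Definition class_A (f : C -> C) : Prop :=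
  analytic_in_disk f /\ f 0%C = 0%C /\ C_derive f 0%C = 1%C.

Definition class_G (alpha : R) (f : C -> C) : Prop :=
  class_A f /\
  (forall z : C, in_disk z -> C_derive f z <> 0%C) /\
  (forall z : C, in_disk z ->
     Re (1 + z * C_derive (C_derive f) z / C_derive f z)%C
       < 1 + / 2 * alpha).

(* f(z) = a 0 + a 1 z + a 2 z^2 + ... throughout the unit disk; this determines
   the coefficients, and forces a 0 = 0 and a 1 = 1 when f is in class_A. *)
Definition has_expansion (f : C -> C) (a : nat -> C) : Prop :=
  forall z : C, in_disk z -> is_Cpseries a z (f z).

Definition hankel2_2 (a : nat -> C) : C :=
  (a 2%nat * a 4%nat - a 3%nat ^ 2)%C.

(* Main.v *)
Require Import Defs.
From Stdlib Require Import Reals Lra Lia Psatz ClassicalEpsilon.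
From Coquelicot Require Import Coquelicot.

(** Put [g = f'], [h = z f''] and [w = - h / (alpha g - h)].  The hypothesis
    [Re (h / g) < alpha / 2] says that [h / g] is closer to [0] than to [alpha], so
    [|w| <= 1] on the disk, and [w = w1 z + w2 z^2 + w3 z^3 + z^4 rho(z)].  Comparing
    coefficients in [w (alpha g - h) = - h] expresses [a 2], [a 3], [a 4] in
    [w1], [w2], [w3], and
<<
  a 2 * a 4 - (a 3)^2 = alpha^2 / 144 * hankel_form alpha w1 w2 w3,
  hankel_form alpha w1 w2 w3
    = 6 w1 w3 + (4 - alpha) w1^2 w2 - 4 w2^2 + (2 - alpha - alpha^2) w1^4.
>>
    The coefficients of a function bounded by 1 satisfy Schur's inequalities: if
    [D = 1 - |w1|^2] is positive,
<<
  |w2| <= D,   |w3 + conj w1 * w2^2 / D| <= D - |w2|^2 / D.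
>>
    With [x = |w1|] and [t = |w2| / D] they bound the form by a function of [x] and
    [t] that increases in [t] ([sharp_estimate]); at [t = 1] it is a quadratic in
    [x^2] whose maximum is exactly the claimed constant.

    Schur's inequalities come from the maximum principle alone.  On [|z| = r] put
    [e = z / r]; for quadratic polynomials [Q], [S] in [e] one has
    [Re ((w(z) / e) Q conj(S)) <= (|Q|^2 + |S|^2) / 2].  Up to constants and to
    replacing negative powers of [e] by the conjugate terms, which have the same
    real part, the difference of the two sides is the real part of a function that
    is holomorphic in the disk and vanishes at [0].  So the inequality holds between
    the constant terms ([contraction_form]), and this says that the lower triangular
    Toeplitz matrix of [w1 r, w2 r^2, w3 r^3] is a contraction.  Suitable test
    vectors give Schur's inequalities for these scaled coefficients, and [r] tends
    to [1].

    The maximum principle needs only second-order expansions with a cubic error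
    term: at an interior maximum [z0] of [Re F + eps |z|^2], the sum of the four
    values at [z0 + t], [z0 - t], [z0 + i t], [z0 - i t] exceeds [4] times the value
    at [z0] by [4 eps t^2 + O(t^3)].  Functions with such expansions are closed under
    sums, products and inverses and contain the power series.  So the quotient [rho]
    qualifies although nothing is said about its own power series, and no complex
    integration is involved. *)

(** * Second-order expansions *)

(** An error factor is only required to be bounded, so continuity of [E] never has to
    be discussed. *)
Definition bounded_near_0 (E : C -> C) : Prop :=
  exists M d : R, 0 < d /\ forall h : C, Cmod h < d -> Cmod (E h) <= M.

Lemma bounded_near_0_const (c : C) : bounded_near_0 (fun _ => c).
Proof. exists (Cmod c), 1; split; [lra | intros; lra]. Qed.

Lemma bounded_near_0_id : bounded_near_0 (fun h => h).
Proof. exists 1, 1; split; [lra | intros; lra]. Qed.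

Lemma bounded_near_0_plus (E1 E2 : C -> C) :
  bounded_near_0 E1 -> bounded_near_0 E2 ->
  bounded_near_0 (fun h => (E1 h + E2 h)%C).
Proof.
  intros [M1 [d1 [hd1 H1]]] [M2 [d2 [hd2 H2]]].
  exists (M1 + M2), (Rmin d1 d2); split; [now apply Rmin_glb_lt|].
  intros h hh.
  pose proof (Rmin_l d1 d2); pose proof (Rmin_r d1 d2).
  specialize (H1 h ltac:(lra)); specialize (H2 h ltac:(lra)).
  eapply Rle_trans; [apply Cmod_triangle | lra].
Qed.

Lemma bounded_near_0_mult (E1 E2 : C -> C) :
  bounded_near_0 E1 -> bounded_near_0 E2 ->
  bounded_near_0 (fun h => (E1 h * E2 h)%C).
Proof.
  intros [M1 [d1 [hd1 H1]]] [M2 [d2 [hd2 H2]]].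
  exists (M1 * M2), (Rmin d1 d2); split; [now apply Rmin_glb_lt|].
  intros h hh.
  pose proof (Rmin_l d1 d2); pose proof (Rmin_r d1 d2).
  specialize (H1 h ltac:(lra)); specialize (H2 h ltac:(lra)).
  rewrite Cmod_mult.
  apply Rmult_le_compat; auto using Cmod_ge_0.
Qed.

Lemma bounded_near_0_ext (E1 E2 : C -> C) (d : R) :
  0 < d -> (forall h, Cmod h < d -> E1 h = E2 h) ->
  bounded_near_0 E1 -> bounded_near_0 E2.
Proof.
  intros hd H [M [d1 [hd1 H1]]].
  exists M, (Rmin d d1); split; [now apply Rmin_glb_lt|].
  intros h hh.
  pose proof (Rmin_l d d1); pose proof (Rmin_r d d1).
  rewrite <- H by lra; apply H1; lra.
Qed.

Ltac bounded :=
  repeat first [ assumption | apply bounded_near_0_const | apply bounded_near_0_id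
               | apply bounded_near_0_plus | apply bounded_near_0_mult ].

(** The remainder is written [h ^ 3 * E h], with an identity valid for every [h], so that
    sums and products of expansions reduce to ring identities.  [c1] is a parameter
    because it is the derivative. *)
Definition has_jet (F : C -> C) (z c1 : C) : Prop :=
  exists (c2 : C) (E : C -> C), bounded_near_0 E /\
    forall h : C, (F (z + h) = F z + c1 * h + c2 * h ^ 2 + h ^ 3 * E h)%C.

(** Away from [0] the factor [E] can be solved for, so a local identity is enough. *)
Lemma has_jet_intro (F : C -> C) (z c1 c2 : C) (E : C -> C) (d : R) :
  0 < d -> bounded_near_0 E ->
  (forall h : C, Cmod h < d ->
     (F (z + h) = F z + c1 * h + c2 * h ^ 2 + h ^ 3 * E h)%C) ->
  has_jet F z c1.
Proof.
  intros hd hE H.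
  set (E' := fun h : C => if Rlt_dec (Cmod h) d then E h
             else ((F (z + h) - F z - c1 * h - c2 * h ^ 2) / h ^ 3)%C).
  exists c2, E'; split.
  - apply (bounded_near_0_ext E E' d); auto.
    intros h hh; unfold E'; destruct (Rlt_dec (Cmod h) d); [reflexivity | lra].
  - intros h; unfold E'; destruct (Rlt_dec (Cmod h) d) as [hh|hh]; [now apply H|].
    assert (h <> 0%C) by (intros ->; rewrite Cmod_0 in hh; lra).
    field; auto.
Qed.

Lemma has_jet_const (c z : C) : has_jet (fun _ => c) z 0%C.
Proof. exists 0%C, (fun _ => 0%C); split; [bounded | intros; ring]. Qed.

Lemma has_jet_id (z : C) : has_jet (fun x => x) z 1%C.
Proof. exists 0%C, (fun _ => 0%C); split; [bounded | intros; ring]. Qed.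

Lemma has_jet_plus (F G : C -> C) (z a b : C) :
  has_jet F z a -> has_jet G z b -> has_jet (fun x => (F x + G x)%C) z (a + b)%C.
Proof.
  intros [c2 [E [hE H]]] [d2 [E' [hE' H']]].
  exists (c2 + d2)%C, (fun h => (E h + E' h)%C); split; [bounded|].
  intros h; rewrite H, H'; ring.
Qed.

Lemma has_jet_mult (F G : C -> C) (z a b : C) :
  has_jet F z a -> has_jet G z b ->
  has_jet (fun x => (F x * G x)%C) z (a * G z + F z * b)%C.
Proof.
  intros [a2 [E [hE H]]] [b2 [E' [hE' H']]].
  exists (a2 * G z + a * b + F z * b2)%C,
    (fun h => (E h * (G z + b * h + b2 * (h * h) + (h * (h * h)) * E' h)
               + E' h * (F z + a * h + a2 * (h * h))
               + a * b2 + a2 * b + a2 * b2 * h)%C); split; [bounded|].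
  intros h; rewrite H, H'; ring.
Qed.

Lemma has_jet_continuous (F : C -> C) (z c1 : C) :
  has_jet F z c1 -> forall e : R, 0 < e ->
  exists d : R, 0 < d /\ forall h : C, Cmod h < d -> Cmod (F (z + h)%C - F z)%C < e.
Proof.
  intros [c2 [E [hE H]]] e he.
  assert (B : bounded_near_0 (fun h => (c1 + c2 * h + (h * h) * E h)%C)) by bounded.
  destruct B as [M [d [hd B]]].
  assert (hM : 0 <= M).
  { eapply Rle_trans; [apply Cmod_ge_0 | apply (B 0%C); rewrite Cmod_0; lra]. }
  exists (Rmin d (e / (M + 1))); split.
  { apply Rmin_glb_lt; auto; apply Rdiv_lt_0_compat; lra. }
  intros h hh.
  pose proof (Rmin_l d (e / (M + 1))); pose proof (Rmin_r d (e / (M + 1))).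
  specialize (B h ltac:(lra)).
  rewrite H.
  replace (F z + c1 * h + c2 * h ^ 2 + h ^ 3 * E h - F z)%C
    with (h * (c1 + c2 * h + (h * h) * E h))%C by ring.
  rewrite Cmod_mult.
  assert (Cmod h * (M + 1) < e).
  { assert (Cmod h < e / (M + 1)) by lra.
    apply (Rmult_lt_compat_r (M + 1)) in H2; [|lra].
    now replace (e / (M + 1) * (M + 1)) with e in H2 by (field; lra). }
  pose proof (Cmod_ge_0 h); nra.
Qed.

(** The coefficients [d0, d1, d2] below are those of the inverse modulo [h ^ 3]; the
    error factor contains [/ F (z + h)], bounded because [|F (z + h)| >= |F z| / 2]
    near [h = 0]. *)
Lemma has_jet_inv (F : C -> C) (z c1 : C) :
  has_jet F z c1 -> F z <> 0%C -> has_jet (fun x => (/ F x)%C) z (- c1 / F z ^ 2)%C.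
Proof.
  intros HF hz.
  assert (hm : 0 < Cmod (F z)) by now apply Cmod_gt_0.
  destruct (has_jet_continuous F z c1 HF (Cmod (F z) / 2) ltac:(lra)) as [d [hd Hd]].
  destruct HF as [c2 [E [hE H]]].
  assert (low : forall h, Cmod h < d -> Cmod (F z) / 2 <= Cmod (F (z + h)%C)).
  { intros h hh; specialize (Hd h hh).
    pose proof (Cmod_triangle (F (z + h)%C) (- (F (z + h)%C - F z))%C).
    replace (F (z + h) + - (F (z + h) - F z))%C with (F z) in H0 by ring.
    rewrite Cmod_opp in H0; lra. }
  assert (nz : forall h, Cmod h < d -> F (z + h)%C <> 0%C).
  { intros h hh; apply Cmod_gt_0; specialize (low h hh); lra. }
  assert (hI : bounded_near_0 (fun h => (/ F (z + h))%C)).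
  { exists (/ (Cmod (F z) / 2)), d; split; auto; intros h hh.
    rewrite Cmod_inv by auto.
    apply Rinv_le_contravar; [lra | auto]. }
  set (d0 := (/ F z)%C); set (d1 := (- c1 / F z ^ 2)%C).
  set (d2 := ((c1 ^ 2 / F z - c2) / F z ^ 2)%C).
  apply (has_jet_intro _ z d1 d2
    (fun h => (/ F (z + h) * (-1 * (c1 * d2 + c2 * d1 + c2 * d2 * h
                 + E h * (d0 + d1 * h + d2 * (h * h)))))%C) d); auto; [bounded|].
  intros h hh; specialize (nz h hh).
  assert (K : (/ F (z + h) * F (z + h) = 1)%C) by now apply Cinv_l.
  replace (/ F z + d1 * h + d2 * h ^ 2)%C
    with ((/ F (z + h) * F (z + h)) * (d0 + d1 * h + d2 * h ^ 2))%C
    by (rewrite K; unfold d0; ring).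
  set (I := (/ F (z + h))%C) in *; rewrite H.
  unfold d0, d1, d2; field; auto.
Qed.

(** * Power series in the unit disk *)

Lemma Cseries_norm_le (u : nat -> C) (l : C) (b : nat -> R) (B : R) :
  @is_series C_AbsRing C_NormedModule u l -> is_series b B ->
  (forall n, Cmod (u n) <= b n) -> Cmod l <= B.
Proof.
  intros Hu Hb H.
  assert (Rbar_le (Cmod l) B); [|assumption].
  apply (is_lim_seq_le (fun n => Cmod (@sum_n C_AbsRing u n)) (sum_n b)).
  - intros n; unfold sum_n.
    eapply Rle_trans; [apply (@norm_sum_n_m C_AbsRing C_NormedModule)|].
    apply sum_n_m_le; exact H.
  - unfold is_lim_seq; simpl.
    apply (filterlim_comp _ _ _ _ (fun x : C => Cmod x) _ _ _ Hu).
    exact (@filterlim_norm C_AbsRing C_NormedModule l).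
  - exact Hb.
Qed.

Lemma Cseries_unique (u : nat -> C) (l l' : C) :
  @is_series C_AbsRing C_NormedModule u l ->
  @is_series C_AbsRing C_NormedModule u l' -> l = l'.
Proof.
  intros H H'.
  exact (@filterlim_locally_unique nat C_AbsRing C_NormedModule eventually _ _ l l' H H').
Qed.

(** Unlike pointwise convergence in the disk, this condition on moduli is visibly stable
    under shifts and under multiplication of the [n]-th coefficient by [n]. *)
Definition abs_summable (a : nat -> C) : Prop :=
  forall rho : R, 0 < rho < 1 -> ex_series (fun n => Cmod (a n) * rho ^ n).

(** Terms of a convergent series are bounded, here at the larger radius [s]; comparison
    with a geometric series of ratio [rho / s] follows. *)
Lemma abs_summable_of_sum (a : nat -> C) (F : C -> C) :
  (forall z, in_disk z -> is_Cpseries a z (F z)) -> abs_summable a.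
Proof.
  intros H rho hrho.
  set (s := (1 + rho) / 2).
  assert (hs : 0 < s < 1) by (unfold s; lra).
  assert (hd : in_disk (RtoC s)) by (unfold in_disk; rewrite Cmod_R, Rabs_pos_eq; lra).
  specialize (H (RtoC s) hd).
  assert (EX : @ex_series C_AbsRing C_NormedModule (fun n => (RtoC s ^ n * a n)%C))
    by (eexists; exact H).
  pose proof (@Cauchy_ex_series C_AbsRing C_CompleteNormedModule _ EX) as CS.
  destruct (CS (mkposreal 1 Rlt_0_1)) as [N HN].
  assert (bd : forall n, (N <= n)%nat -> Cmod (a n) * s ^ n <= 1).
  { intros n hn.
    specialize (HN n n hn hn).
    rewrite sum_n_n in HN.
    change (Cmod (RtoC s ^ n * a n)%C < 1) in HN.
    rewrite Cmod_mult, Cmod_pow, Cmod_R, Rabs_pos_eq in HN; lra. }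
  apply (ex_series_incr_n (fun n => Cmod (a n) * rho ^ n) N).
  apply (@ex_series_le R_AbsRing R_CompleteNormedModule _
    (fun k => (rho / s) ^ k)).
  - intros k.
    change (Rabs (Cmod (a (N + k)%nat) * rho ^ (N + k)) <= (rho / s) ^ k).
    rewrite Rabs_pos_eq by (apply Rmult_le_pos; [apply Cmod_ge_0 | apply pow_le; lra]).
    assert (hq : 0 < rho / s <= 1).
    { split; [apply Rdiv_lt_0_compat; lra|].
      apply Rmult_le_reg_r with s; [lra|]; unfold Rdiv.
      rewrite Rmult_assoc, Rinv_l by lra; unfold s; lra. }
    replace rho with (s * (rho / s)) at 1 by (field; lra).
    rewrite Rpow_mult_distr, <- Rmult_assoc.
    specialize (bd (N + k)%nat ltac:(lia)).
    assert (0 < (rho / s) ^ (N + k)) by (apply pow_lt; lra).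
    apply Rle_trans with (1 * (rho / s) ^ (N + k)).
    { apply Rmult_le_compat_r; lra. }
    rewrite pow_add, Rmult_1_l.
    assert ((rho / s) ^ N <= 1).
    { rewrite <- (pow1 N); apply pow_incr; lra. }
    assert (0 < (rho / s) ^ k) by (apply pow_lt; lra).
    nra.
  - apply ex_series_geom.
    rewrite Rabs_pos_eq.
    + apply Rmult_lt_reg_r with s; [lra|]; unfold Rdiv.
      rewrite Rmult_assoc, Rinv_l by lra; unfold s; lra.
    + apply Rlt_le, Rdiv_lt_0_compat; lra.
Qed.

Lemma abs_summable_shift (a : nat -> C) :
  abs_summable a -> abs_summable (fun n => a (S n)).
Proof.
  intros H rho hrho.
  pose proof (proj1 (ex_series_incr_1 _) (H rho hrho)) as K.
  apply (ex_series_scal_r (/ rho)) in K.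
  eapply ex_series_ext; [|exact K].
  intros n; simpl; field; lra.
Qed.

(** Bernoulli's inequality [1 + n t <= (1 + t) ^ n] with [1 + t = s / rho] lets the
    passage from [rho] to [s] absorb the factor [n]. *)
Lemma abs_summable_INR (a : nat -> C) :
  abs_summable a -> abs_summable (fun n => (INR n * a n)%C).
Proof.
  intros H rho hrho.
  set (s := (1 + rho) / 2).
  assert (hs : 0 < s < 1) by (unfold s; lra).
  assert (hss : rho < s) by (unfold s; lra).
  set (t := s / rho - 1).
  assert (ht : 0 < t).
  { unfold t; apply Rmult_lt_reg_r with rho; [lra|].
    replace ((s / rho - 1) * rho) with (s - rho) by (field; lra); lra. }
  apply (@ex_series_le R_AbsRing R_CompleteNormedModule _
    (fun n => Cmod (a n) * s ^ n * / t)).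
  - intros n.
    change (Rabs (Cmod (INR n * a n)%C * rho ^ n) <= Cmod (a n) * s ^ n * / t).
    rewrite Rabs_pos_eq by (apply Rmult_le_pos; [apply Cmod_ge_0 | apply pow_le; lra]).
    rewrite Cmod_mult, Cmod_R, Rabs_pos_eq by apply pos_INR.
    replace s with ((1 + t) * rho) by (unfold t; field; lra).
    rewrite Rpow_mult_distr.
    pose proof (poly n t ht) as P.
    assert (0 < rho ^ n) by (apply pow_lt; lra).
    pose proof (Cmod_ge_0 (a n)).
    assert (INR n <= (1 + t) ^ n * / t).
    { apply Rmult_le_reg_r with t; [lra|].
      rewrite Rmult_assoc, Rinv_l by lra; lra. }
    assert (0 <= Cmod (a n) * rho ^ n) by (apply Rmult_le_pos; lra).
    nra.
  - apply ex_series_scal_r, H; lra.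
Qed.

(** [ddiff j n z] is [binomial n j * z ^ (n - j)] and [drem j n z h] is the divided
    difference of [x ^ n] on the [j + 1] nodes [z] and the node [z + h].  These recursions
    make both the Taylor identity ([drem_0], [drem_S]) and the bounds by [n ^ j]
    immediate inductions. *)
Fixpoint ddiff (j n : nat) (z : C) : C :=
  match n with
  | O => match j with O => 1 | S _ => 0 end
  | S m => (z * ddiff j m z + match j with O => 0 | S i => ddiff i m z end)%C
  end.

Fixpoint drem (j n : nat) (z h : C) : C :=
  match n with
  | O => 0
  | S m => ((z + h) * drem j m z h + ddiff j m z)%C
  end.

Lemma ddiff_0 (n : nat) (z : C) : ddiff 0 n z = (z ^ n)%C.
Proof. induction n as [|n IH]; simpl; [reflexivity | rewrite IH; simpl; ring]. Qed.

Lemma ddiff_1 (n : nat) (z : C) : ddiff 1 (S n) z = (INR (S n) * z ^ n)%C.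
Proof.
  induction n as [|n IH].
  - simpl; ring.
  - change (ddiff 1 (S (S n)) z) with (z * ddiff 1 (S n) z + ddiff 0 (S n) z)%C.
    rewrite IH, ddiff_0, (S_INR (S n)), RtoC_plus; simpl (z ^ _)%C; ring.
Qed.

Lemma drem_0 (n : nat) (z h : C) :
  ((z + h) ^ n = ddiff 0 n z + h * drem 0 n z h)%C.
Proof.
  induction n as [|n IH]; [simpl; ring|].
  change ((z + h) ^ S n)%C with ((z + h) * (z + h) ^ n)%C.
  rewrite IH; simpl; ring.
Qed.

Lemma drem_S (j n : nat) (z h : C) :
  (drem j n z h = ddiff (S j) n z + h * drem (S j) n z h)%C.
Proof.
  induction n as [|n IH]; [simpl; ring|].
  simpl; rewrite IH; ring.
Qed.

Lemma ddiff_bound (j n : nat) (z : C) (rho : R) :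
  Cmod z <= rho -> Cmod (ddiff j n z) * rho ^ j <= INR n ^ j * rho ^ n.
Proof.
  intros hz.
  assert (hr : 0 <= rho) by (pose proof (Cmod_ge_0 z); lra).
  revert j; induction n as [|n IH]; intros j.
  - destruct j; simpl; rewrite ?Cmod_1, ?Cmod_0; lra.
  - simpl ddiff.
    apply Rle_trans with
      ((Cmod z * Cmod (ddiff j n z) + Cmod (match j with O => 0 | S i => ddiff i n z end)%C)
        * rho ^ j).
    { apply Rmult_le_compat_r; [apply pow_le; lra|].
      eapply Rle_trans; [apply Cmod_triangle|]; rewrite Cmod_mult; lra. }
    destruct j as [|i].
    + rewrite Cmod_0; pose proof (IH 0%nat) as K; simpl in K |- *.
      pose proof (Cmod_ge_0 (ddiff 0 n z)).
      assert (Cmod z * Cmod (ddiff 0 n z) <= rho * Cmod (ddiff 0 n z))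
        by (apply Rmult_le_compat_r; lra).
      nra.
    + pose proof (IH (S i)) as K1; pose proof (IH i) as K2.
      rewrite S_INR.
      assert (P : INR n ^ S i + INR n ^ i <= (INR n + 1) ^ S i).
      { simpl. pose proof (pos_INR n).
        assert (INR n ^ i <= (INR n + 1) ^ i) by (apply pow_incr; lra). nra. }
      pose proof (Cmod_ge_0 (ddiff (S i) n z)).
      assert (Q : 0 <= rho ^ S i) by (apply pow_le; lra).
      assert (Q2 : 0 <= rho ^ n) by (apply pow_le; lra).
      assert (T1 : Cmod z * Cmod (ddiff (S i) n z) * rho ^ S i
                   <= rho * (INR n ^ S i * rho ^ n)).
      { rewrite Rmult_assoc; apply Rmult_le_compat; auto using Cmod_ge_0.
        apply Rmult_le_pos; auto. }
      assert (T2 : Cmod (ddiff i n z) * rho ^ S i <= rho * (INR n ^ i * rho ^ n)).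
      { simpl. replace (Cmod (ddiff i n z) * (rho * rho ^ i))
          with (rho * (Cmod (ddiff i n z) * rho ^ i)) by ring.
        apply Rmult_le_compat_l; lra. }
      assert (T3 : rho * rho ^ n * (INR n ^ S i + INR n ^ i)
                   <= rho * rho ^ n * (INR n + 1) ^ S i).
      { apply Rmult_le_compat_l; [|lra]; apply Rmult_le_pos; lra. }
      change (rho ^ S n) with (rho * rho ^ n). lra.
Qed.

Lemma drem_bound (j n : nat) (z h : C) (rho : R) :
  Cmod z <= rho -> Cmod (z + h)%C <= rho ->
  Cmod (drem j n z h) * rho ^ S j <= INR n ^ S j * rho ^ n.
Proof.
  intros hz hzh.
  assert (hr : 0 <= rho) by (pose proof (Cmod_ge_0 z); lra).
  induction n as [|n IH].
  - simpl; rewrite Cmod_0; lra.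
  - simpl drem.
    apply Rle_trans with
      ((Cmod (z + h)%C * Cmod (drem j n z h) + Cmod (ddiff j n z)) * rho ^ S j).
    { apply Rmult_le_compat_r; [apply pow_le; lra|].
      eapply Rle_trans; [apply Cmod_triangle|]; rewrite Cmod_mult; lra. }
    pose proof (ddiff_bound j n z rho hz) as K2.
    rewrite S_INR.
    assert (P : INR n ^ S j + INR n ^ j <= (INR n + 1) ^ S j).
    { simpl. pose proof (pos_INR n).
      assert (INR n ^ j <= (INR n + 1) ^ j) by (apply pow_incr; lra). nra. }
    assert (Q : 0 <= rho ^ S j) by (apply pow_le; lra).
    assert (Q2 : 0 <= rho ^ n) by (apply pow_le; lra).
    assert (T1 : Cmod (z + h)%C * Cmod (drem j n z h) * rho ^ S j
                 <= rho * (INR n ^ S j * rho ^ n)).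
    { rewrite Rmult_assoc; apply Rmult_le_compat; auto using Cmod_ge_0.
      apply Rmult_le_pos; auto using Cmod_ge_0. }
    assert (T2 : Cmod (ddiff j n z) * rho ^ S j <= rho * (INR n ^ j * rho ^ n)).
    { simpl. replace (Cmod (ddiff j n z) * (rho * rho ^ j))
        with (rho * (Cmod (ddiff j n z) * rho ^ j)) by ring.
      apply Rmult_le_compat_l; lra. }
    assert (T3 : rho * rho ^ n * (INR n ^ S j + INR n ^ j)
                 <= rho * rho ^ n * (INR n + 1) ^ S j).
    { apply Rmult_le_compat_l; [|lra]; apply Rmult_le_pos; lra. }
    change (rho ^ S n) with (rho * rho ^ n). lra.
Qed.

Lemma abs_summable_moments (a : nat -> C) (rho : R) (j : nat) :
  abs_summable a -> 0 < rho < 1 ->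
  ex_series (fun n => INR n ^ j * rho ^ n * Cmod (a n)).
Proof.
  intros H hrho; revert a H; induction j as [|j IH]; intros a H.
  - eapply ex_series_ext; [|exact (H rho hrho)]; intros n; simpl; ring.
  - eapply ex_series_ext; [|exact (IH _ (abs_summable_INR a H))].
    intros n; simpl; rewrite Cmod_mult, Cmod_R, Rabs_pos_eq by apply pos_INR; ring.
Qed.

Definition Csum (a : nat -> C) (z : C) : C :=
  iota (fun l : C_CompleteNormedModule => is_Cpseries a z l).

Lemma Csum_intro (a : nat -> C) (z l : C) : is_Cpseries a z l -> Csum a z = l.
Proof.
  intros H; symmetry.
  apply Cseries_unique with (1 := H).
  change (is_Cpseries a z (Csum a z)); unfold Csum.
  apply (@iota_correct C_AbsRing C_CompleteNormedModule (fun l : C => is_Cpseries a z l)).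
  exists l; split; [exact H | intros x hx; exact (Cseries_unique _ _ _ H hx)].
Qed.

Lemma Csum_correct (a : nat -> C) (z : C) :
  abs_summable a -> in_disk z -> is_Cpseries a z (Csum a z).
Proof.
  intros H hz.
  assert (EX : @ex_series C_AbsRing C_NormedModule (fun n => (z ^ n * a n)%C)).
  { set (rho := (1 + Cmod z) / 2).
    unfold in_disk in hz; pose proof (Cmod_ge_0 z).
    apply (@ex_series_le C_AbsRing C_CompleteNormedModule _
             (fun n => Cmod (a n) * rho ^ n)).
    - intros n; change (Cmod (z ^ n * a n)%C <= Cmod (a n) * rho ^ n).
      rewrite Cmod_mult, Cmod_pow, Rmult_comm.
      apply Rmult_le_compat_l; [apply Cmod_ge_0|].
      apply pow_incr; unfold rho; lra.
    - apply H; unfold rho; lra. }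
  destruct EX as [l Hl].
  now rewrite (Csum_intro a z l Hl).
Qed.

Definition derive_coeffs (a : nat -> C) (n : nat) : C := (INR (S n) * a (S n))%C.

Lemma abs_summable_derive (a : nat -> C) :
  abs_summable a -> abs_summable (derive_coeffs a).
Proof. intros H; exact (abs_summable_shift _ (abs_summable_INR a H)). Qed.

(** Summing the Taylor identities of the monomials: the cubic remainder of [z ^ n] is at
    most [n ^ 3 * rho ^ (n - 3) * |h| ^ 3] as long as [z] and [z + h] have modulus at most
    [rho], and [n ^ 3 * rho ^ n * |a n|] is summable. *)
Lemma Csum_has_jet (a : nat -> C) (z : C) :
  abs_summable a -> in_disk z -> has_jet (Csum a) z (Csum (derive_coeffs a) z).
Proof.
  intros H hz; unfold in_disk in hz; pose proof (Cmod_ge_0 z) as hz0.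
  set (rho := (1 + Cmod z) / 2).
  assert (hrho : 0 < rho < 1) by (unfold rho; lra).
  assert (hzr : Cmod z <= rho) by (unfold rho; lra).
  assert (S0 : @is_series C_AbsRing C_NormedModule (fun n => (ddiff 0 n z * a n)%C)
                 (Csum a z)).
  { eapply is_series_ext; [|exact (Csum_correct a z H hz)].
    intros n; rewrite ddiff_0; reflexivity. }
  assert (S1 : @is_series C_AbsRing C_NormedModule (fun n => (ddiff 1 n z * a n)%C)
                 (Csum (derive_coeffs a) z)).
  { apply is_series_decr_1.
    match goal with |- is_series _ ?l => replace l with (Csum (derive_coeffs a) z) end.
    2:{ change (Csum (derive_coeffs a) z
             = Csum (derive_coeffs a) z + - (ddiff 1 0 z * a 0%nat))%C; simpl; ring. }
    eapply is_series_ext; [|exact (Csum_correct _ z (abs_summable_derive a H) hz)].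
    intros n; rewrite ddiff_1; unfold derive_coeffs.
    change (z ^ n * (INR (S n) * a (S n)) = INR (S n) * z ^ n * a (S n))%C; ring. }
  assert (EX : @ex_series C_AbsRing C_NormedModule (fun n => (ddiff 2 n z * a n)%C)).
  { apply (@ex_series_le C_AbsRing C_CompleteNormedModule _
             (fun n => INR n ^ 2 * rho ^ n * Cmod (a n) * / rho ^ 2)).
    - intros n; change (Cmod (ddiff 2 n z * a n)%C
                        <= INR n ^ 2 * rho ^ n * Cmod (a n) * / rho ^ 2).
      pose proof (ddiff_bound 2 n z rho hzr) as K.
      assert (0 < rho ^ 2) by (apply pow_lt; lra).
      rewrite Cmod_mult.
      apply Rmult_le_reg_r with (rho ^ 2); auto.
      rewrite !Rmult_assoc, Rinv_l by lra; rewrite <- !Rmult_assoc, Rmult_1_r.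
      pose proof (Cmod_ge_0 (a n)); nra.
    - apply ex_series_scal_r; now apply abs_summable_moments. }
  destruct EX as [c2 S2].
  pose proof (abs_summable_moments a rho 3 H hrho) as M3.
  destruct (ex_series_scal_r (/ rho ^ 3) _ M3) as [B HB].
  assert (hd : 0 < (1 - Cmod z) / 2) by lra.
  set (E := fun h : C =>
    ((Csum a (z + h)%C - Csum a z - Csum (derive_coeffs a) z * h - c2 * h ^ 2) / h ^ 3)%C).
  assert (bd : forall h : C, Cmod h < (1 - Cmod z) / 2 ->
    Cmod (Csum a (z + h)%C - Csum a z - Csum (derive_coeffs a) z * h - c2 * h ^ 2)%C
      <= Cmod h ^ 3 * B).
  { intros h hh.
    assert (hzh : Cmod (z + h)%C <= rho)
      by (eapply Rle_trans; [apply Cmod_triangle | unfold rho; lra]).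
    assert (hin : in_disk (z + h)%C) by (unfold in_disk; lra).
    pose proof (Csum_correct a _ H hin) as SH.
    apply (Cseries_norm_le (fun n => (h ^ 3 * (drem 2 n z h * a n))%C) _
      (fun n => Cmod h ^ 3 * (INR n ^ 3 * rho ^ n * Cmod (a n) * / rho ^ 3))).
    - pose proof (is_series_minus _ _ _ _
        (is_series_minus _ _ _ _ (is_series_minus _ _ _ _ SH S0)
           (is_series_scal h _ _ S1)) (is_series_scal (h ^ 2)%C _ _ S2)) as T.
      match type of T with is_series _ ?l => replace l with
        (Csum a (z + h)%C - Csum a z - Csum (derive_coeffs a) z * h - c2 * h ^ 2)%C in T end.
      2:{ change (Csum a (z + h) - Csum a z - Csum (derive_coeffs a) z * h - c2 * h ^ 2
           = Csum a (z + h) + - Csum a z + - (h * Csum (derive_coeffs a) z)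
             + - (h ^ 2 * c2))%C; ring. }
      eapply is_series_ext; [|exact T]; intros n.
      change ((z + h) ^ n * a n + - (ddiff 0 n z * a n) + - (h * (ddiff 1 n z * a n))
              + - (h ^ 2 * (ddiff 2 n z * a n)) = h ^ 3 * (drem 2 n z h * a n))%C.
      rewrite drem_0, (drem_S 0), (drem_S 1); ring.
    - exact (is_series_scal (Cmod h ^ 3) _ _ HB).
    - intros n; rewrite !Cmod_mult, Cmod_pow.
      apply Rmult_le_compat_l; [apply pow_le, Cmod_ge_0|].
      pose proof (drem_bound 2 n z h rho hzr hzh) as K.
      assert (0 < rho ^ 3) by (apply pow_lt; lra).
      apply Rmult_le_reg_r with (rho ^ 3); auto.
      rewrite !Rmult_assoc, Rinv_l by lra; rewrite <- !Rmult_assoc, Rmult_1_r.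
      pose proof (Cmod_ge_0 (a n)); nra. }
  assert (hB : 0 <= B).
  { specialize (bd (RtoC ((1 - Cmod z) / 4))).
    rewrite Cmod_R, Rabs_pos_eq in bd by lra.
    specialize (bd ltac:(lra)).
    assert (0 < ((1 - Cmod z) / 4) ^ 3) by (apply pow_lt; lra).
    match type of bd with ?x <= _ => assert (0 <= x) by apply Cmod_ge_0 end.
    apply Rmult_le_reg_l with (((1 - Cmod z) / 4) ^ 3); lra. }
  exists c2, (fun h => if Req_EM_T (Cmod h) 0 return C then 0%C else E h); split.
  - exists B, ((1 - Cmod z) / 2); split; [lra|].
    intros h hh; destruct (Req_EM_T (Cmod h) 0) as [e|e]; [now rewrite Cmod_0|].
    assert (h <> 0%C) by (intros ->; apply e, Cmod_0).
    assert (0 < Cmod h) by now apply Cmod_gt_0.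
    unfold E; rewrite Cmod_div by now apply Cpow_nz.
    rewrite Cmod_pow.
    apply Rmult_le_reg_r with (Cmod h ^ 3); [now apply pow_lt|].
    unfold Rdiv; rewrite Rmult_assoc, Rinv_l, Rmult_1_r by (apply pow_nonzero; lra).
    specialize (bd h hh); lra.
  - intros h; destruct (Req_EM_T (Cmod h) 0) as [e|e].
    + apply Cmod_eq_0 in e; subst h. replace (z + 0)%C with z by ring; ring.
    + assert (h <> 0%C) by (intros ->; apply e, Cmod_0).
      unfold E; field; auto.
Qed.

Lemma has_jet_C_derive (F : C -> C) (z c1 : C) :
  has_jet F z c1 -> C_derive F z = c1.
Proof.
  intros [c2 [E [hE H]]]; unfold C_derive.
  assert (B : bounded_near_0 (fun h => (c2 + h * E h)%C)) by bounded.
  destruct B as [M [d [hd B]]].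
  assert (hM : 0 <= M).
  { eapply Rle_trans; [apply Cmod_ge_0 | apply (B 0%C); rewrite Cmod_0; lra]. }
  apply is_C_lim_unique.
  apply (@filterlim_locally_ball_norm C_AbsRing C C_NormedModule); [typeclasses eauto|].
  intros eps.
  unfold locally', within.
  apply (@locally_le_locally_norm C_AbsRing C_NormedModule).
  assert (he : 0 < Rmin d (eps / (M + 1))).
  { apply Rmin_glb_lt; auto; apply Rdiv_lt_0_compat; [apply cond_pos | lra]. }
  exists (mkposreal _ he); intros x0 hx hne; set (x := x0 : C) in *.
  change (Cmod (x - z)%C < Rmin d (eps / (M + 1))) in hx.
  change (Cmod ((F x - F z) / (x - z) - c1)%C < eps).
  pose proof (Rmin_l d (eps / (M + 1))); pose proof (Rmin_r d (eps / (M + 1))).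
  set (h := (x - z)%C) in *.
  assert (hh : h <> 0%C).
  { intros e; apply hne; change (x = z).
    replace x with (h + z)%C by (unfold h; ring); rewrite e; ring. }
  replace (F x) with (F z + c1 * h + c2 * h ^ 2 + h ^ 3 * E h)%C
    by (rewrite <- H; f_equal; unfold h; ring).
  replace ((F z + c1 * h + c2 * h ^ 2 + h ^ 3 * E h - F z) / h - c1)%C
    with (h * (c2 + h * E h))%C by (field; auto).
  rewrite Cmod_mult.
  specialize (B h ltac:(lra)).
  assert (Cmod h * (M + 1) < eps).
  { assert (Cmod h < eps / (M + 1)) by lra.
    apply (Rmult_lt_compat_r (M + 1)) in H2; [|lra].
    now replace (eps / (M + 1) * (M + 1)) with (pos eps) in H2 by (field; lra). }
  pose proof (Cmod_ge_0 h); nra.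
Qed.

Lemma has_jet_ext_disk (F G : C -> C) (z c1 : C) :
  (forall x, in_disk x -> F x = G x) -> in_disk z ->
  has_jet F z c1 -> has_jet G z c1.
Proof.
  intros HFG hz [c2 [E [hE H]]].
  unfold in_disk in hz.
  apply (has_jet_intro G z c1 c2 E (1 - Cmod z)); auto; [lra|].
  intros h hh; rewrite <- !HFG; auto.
  unfold in_disk; eapply Rle_lt_trans; [apply Cmod_triangle | lra].
Qed.

(** * The maximum principle *)

Lemma continuity_pt_intro (f : R -> R) (x : R) :
  (forall e, 0 < e -> exists d, 0 < d /\
     forall x', Rabs (x' - x) < d -> Rabs (f x' - f x) < e) -> continuity_pt f x.
Proof.
  intros H e he; destruct (H e he) as [d [hd Hd]].
  exists d; split; [exact hd|].
  intros x' [_ hx']; apply Hd, hx'.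
Qed.

(** Maximize over [y] first; uniform continuity makes the maximum a continuous function
    of [x].  The clamp [k] makes that function total. *)
Lemma rectangle_max (f : R -> R -> R) (a b c d : R) :
  a <= b -> c <= d ->
  (forall x y, a <= x <= b -> c <= y <= d -> continuity_2d_pt f x y) ->
  exists x0 y0, a <= x0 <= b /\ c <= y0 <= d /\
    forall x y, a <= x <= b -> c <= y <= d -> f x y <= f x0 y0.
Proof.
  intros hab hcd hf.
  set (k := fun x => Rmax a (Rmin b x)).
  assert (hk : forall x, a <= k x <= b).
  { intros x; unfold k; split; [apply Rmax_l|].
    apply Rmax_lub; [lra | apply Rmin_l]. }
  assert (hk2 : forall x, a <= x <= b -> k x = x).
  { intros x hx; unfold k; rewrite Rmin_right, Rmax_right; lra. }
  assert (hk3 : forall x x', Rabs (k x' - k x) <= Rabs (x' - x)).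
  { intros x x'; unfold k, Rmax, Rmin.
    repeat destruct Rle_dec; apply Rabs_le; split;
      unfold Rabs; destruct Rcase_abs; lra. }
  assert (ch : forall x, exists y, c <= y <= d /\
    forall y', c <= y' <= d -> f (k x) y' <= f (k x) y).
  { intros x.
    destruct (continuity_ab_maj (f (k x)) c d hcd) as [y [H1 H2]]; [|exists y; auto].
    intros y hy; apply continuity_pt_intro; intros e he.
    destruct (hf (k x) y (hk x) hy (mkposreal e he)) as [dl Hd].
    exists dl; split; [apply cond_pos|]; intros y' hy'.
    apply Hd; [rewrite Rminus_diag, Rabs_R0; apply cond_pos | exact hy']. }
  set (phi := fun x => proj1_sig (constructive_indefinite_description _ (ch x))).
  assert (hphi : forall x, c <= phi x <= d /\ forall y', c <= y' <= d -> f (k x) y' <= f (k x) (phi x))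
    by (intros x; exact (proj2_sig (constructive_indefinite_description _ (ch x)))).
  clearbody phi.
  destruct (continuity_ab_maj (fun x => f (k x) (phi x)) a b hab) as [x0 [H1 H2]].
  - intros x hx; apply continuity_pt_intro; intros e he.
    destruct (uniform_continuity_2d f a b c d hf (mkposreal e he)) as [dl Hd].
    exists dl; split; [apply cond_pos|]; intros x' hx'.
    assert (E : forall y, c <= y <= d -> Rabs (f (k x') y - f (k x) y) < e).
    { intros y hy; apply Hd; auto.
      - eapply Rle_lt_trans; [apply hk3 | exact hx'].
      - rewrite Rminus_diag, Rabs_R0; apply cond_pos. }
    destruct (hphi x) as [p1 p2]; destruct (hphi x') as [q1 q2].
    pose proof (E _ p1) as E1; pose proof (E _ q1) as E2.
    pose proof (p2 _ q1); pose proof (q2 _ p1).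
    apply Rabs_def2 in E1; apply Rabs_def2 in E2.
    apply Rabs_def1; lra.
  - exists x0, (phi x0); split; [auto|]; split; [apply hphi|].
    intros x y hx hy.
    specialize (H1 x hx); simpl in H1.
    destruct (hphi x) as [p1 p2]; specialize (p2 y hy).
    rewrite (hk2 x0 H2) in *; rewrite (hk2 x hx) in *; lra.
Qed.

Definition continuous_on_disk (u : C -> R) : Prop :=
  forall z, in_disk z -> forall e, 0 < e ->
    exists d, 0 < d /\ forall h, Cmod h < d -> Rabs (u (z + h)%C - u z) < e.

Lemma Cmod_le_parts (x y : R) : Cmod (x, y) <= Rabs x + Rabs y.
Proof.
  apply Rsqr_incr_0_var; [|pose proof (Rabs_pos x); pose proof (Rabs_pos y); lra].
  rewrite !Rsqr_pow2, Cmod2_alt; simpl.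
  pose proof (Rabs_pos x); pose proof (Rabs_pos y).
  pose proof (pow2_abs x); pose proof (pow2_abs y); simpl in *; nra.
Qed.

(** The map sending [(x, y)] to [(x, y * sqrt (r ^ 2 - x ^ 2))] takes a rectangle onto the
    disk of radius [r], which transfers the previous lemma. *)
Lemma disk_max (u : C -> R) (r : R) :
  continuous_on_disk u -> 0 < r < 1 ->
  exists z0, Cmod z0 <= r /\ forall z, Cmod z <= r -> u z <= u z0.
Proof.
  intros hu hr.
  set (p := fun x y : R => y * sqrt (r ^ 2 - x ^ 2)).
  assert (hp : forall x y, -r <= x <= r -> -1 <= y <= 1 -> Cmod (x, p x y) <= r).
  { intros x y hx hy.
    apply Rsqr_incr_0_var; [|lra].
    rewrite !Rsqr_pow2, Cmod2_alt; simpl Re; simpl Im; unfold p.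
    assert (0 <= r ^ 2 - x ^ 2) by nra.
    rewrite Rpow_mult_distr, pow2_sqrt by assumption.
    assert (0 <= 1 - y ^ 2) by nra; nra. }
  destruct (rectangle_max (fun x y => u (x, p x y)) (-r) r (-1) 1)
    as [x0 [y0 [hx0 [hy0 H]]]]; try lra.
  - intros x y hx hy.
    assert (pc : continuity_2d_pt p x y).
    { unfold p; apply continuity_2d_pt_mult; [apply continuity_2d_pt_id2|].
      apply (continuity_1d_2d_pt_comp sqrt (fun u v => r ^ 2 - u ^ 2)).
      - apply continuity_pt_sqrt.
        assert (0 <= (r - x) * (r + x)) by (apply Rmult_le_pos; lra); lra.
      - apply continuity_2d_pt_minus; [apply continuity_2d_pt_const|].
        apply continuity_2d_pt_ext with (fun u v => u * u); [intros; ring|].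
        apply continuity_2d_pt_mult; apply continuity_2d_pt_id1. }
    intros eps.
    assert (hin : in_disk (x, p x y))
      by (unfold in_disk; pose proof (hp x y hx hy); lra).
    destruct (hu _ hin eps (cond_pos eps)) as [d [hd Hd]].
    assert (hd2 : 0 < d / 2) by lra.
    destruct (pc (mkposreal _ hd2)) as [dl Hdl].
    assert (hm : 0 < Rmin (d / 2) dl) by (apply Rmin_glb_lt; [lra | apply cond_pos]).
    exists (mkposreal _ hm); simpl; intros x' y' hx' hy'.
    pose proof (Rmin_l (d / 2) dl); pose proof (Rmin_r (d / 2) dl).
    specialize (Hdl x' y' ltac:(lra) ltac:(lra)); simpl in Hdl.
    specialize (Hd (x' - x, p x' y' - p x y)).
    replace (Cplus (x, p x y) (x' - x, p x' y' - p x y)) with ((x', p x' y') : C) in Hd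
      by (unfold Cplus; simpl; f_equal; ring).
    apply Hd; eapply Rle_lt_trans; [apply Cmod_le_parts | lra].
  - exists (x0, p x0 y0); split; [auto|].
    intros [x t] hz.
    assert (hz2 : x ^ 2 + t ^ 2 <= r ^ 2).
    { pose proof (Cmod2_alt (x, t)) as K; simpl Re in K; simpl Im in K.
      rewrite <- K; apply pow_incr; split; [apply Cmod_ge_0 | auto]. }
    assert (hx : -r <= x <= r) by (split; nra).
    destruct (Req_dec (r ^ 2 - x ^ 2) 0) as [e|e].
    + assert (t = 0) by nra; subst t.
      specialize (H x 0 hx ltac:(lra)); unfold p in H at 1.
      now rewrite Rmult_0_l in H.
    + assert (hs : 0 < sqrt (r ^ 2 - x ^ 2)) by (apply sqrt_lt_R0; nra).
      assert (hs2 : sqrt (r ^ 2 - x ^ 2) ^ 2 = r ^ 2 - x ^ 2) by (apply pow2_sqrt; nra).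
      set (s := sqrt (r ^ 2 - x ^ 2)) in *.
      assert (hts : -1 <= t / s <= 1).
      { assert (-s <= t <= s) by (split; nra).
        split; apply Rmult_le_reg_r with s; auto; unfold Rdiv;
          rewrite Rmult_assoc, Rinv_l; lra. }
      specialize (H x (t / s) hx hts).
      replace (p x (t / s)) with t in H by (unfold p; fold s; field; lra); exact H.
Qed.

(** These are the holomorphic functions of the disk.  The definition asks for just what
    the four-point argument consumes and what quotients inherit. *)
Definition regular (F : C -> C) : Prop :=
  forall z, in_disk z -> exists c1, has_jet F z c1.

Lemma regular_const (c : C) : regular (fun _ => c).
Proof. intros z hz; eexists; apply has_jet_const. Qed.

Lemma regular_id : regular (fun x => x).
Proof. intros z hz; eexists; apply has_jet_id. Qed.

Lemma regular_plus (F G : C -> C) :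
  regular F -> regular G -> regular (fun x => (F x + G x)%C).
Proof.
  intros hF hG z hz; destruct (hF z hz), (hG z hz).
  eexists; apply has_jet_plus; eassumption.
Qed.

Lemma regular_mult (F G : C -> C) :
  regular F -> regular G -> regular (fun x => (F x * G x)%C).
Proof.
  intros hF hG z hz; destruct (hF z hz), (hG z hz).
  eexists; apply has_jet_mult; eassumption.
Qed.

Lemma regular_inv (F : C -> C) :
  regular F -> (forall z, in_disk z -> F z <> 0%C) -> regular (fun x => (/ F x)%C).
Proof.
  intros hF hnz z hz; destruct (hF z hz).
  eexists; apply has_jet_inv; eauto.
Qed.

Ltac regular :=
  repeat first [ assumption | apply regular_const | apply regular_id
               | apply regular_plus | apply regular_mult ].

(** Over the four points [z + t k], [k] in [{1, -1, i, -i}], the linear and quadratic terms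
    of [F] cancel, while [eps * |.| ^ 2] gains [4 * eps * t ^ 2], more than the four cubic
    remainders can take back when [t * (M + 1) < eps]. *)
Lemma four_point_max (F : C -> C) (z c1 : C) (eps d : R) :
  has_jet F z c1 -> 0 < eps -> 0 < d ->
  exists h, Cmod h < d /\
    Re (F z) + eps * Cmod z ^ 2 < Re (F (z + h)%C) + eps * Cmod (z + h)%C ^ 2.
Proof.
  intros [c2 [E [[M [d0 [hd0 hE]]] H]]] heps hd.
  assert (hM : 0 <= M).
  { eapply Rle_trans; [apply Cmod_ge_0 | apply (hE 0%C); rewrite Cmod_0; lra]. }
  set (m := Rmin (Rmin d d0) (eps / (M + 1))).
  assert (hm : 0 < m).
  { repeat apply Rmin_glb_lt; auto; apply Rdiv_lt_0_compat; lra. }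
  assert (m <= d /\ m <= d0 /\ m <= eps / (M + 1)) as [hmd [hmd0 hme]].
  { unfold m; pose proof (Rmin_l (Rmin d d0) (eps / (M + 1)));
    pose proof (Rmin_r (Rmin d d0) (eps / (M + 1)));
    pose proof (Rmin_l d d0); pose proof (Rmin_r d d0); lra. }
  set (t := m / 2).
  assert (ht : 0 < t) by (unfold t; lra).
  assert (hte : t * (M + 1) < eps).
  { apply Rlt_le_trans with (m * (M + 1)); [unfold t; nra|].
    apply (Rmult_le_compat_r (M + 1)) in hme; [|lra].
    now replace (eps / (M + 1) * (M + 1)) with eps in hme by (field; lra). }
  (* If none of the four points increased the value, neither would their sum. *)
  assert (bound : forall k : C, Cmod k = 1 ->
    Rabs (Re ((t * k) ^ 3 * E (t * k))%C) <= t ^ 3 * M).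
  { intros k hk; eapply Rle_trans; [apply re_le_Cmod|].
    assert (hmod : Cmod (t * k)%C = t)
      by (rewrite Cmod_mult, Cmod_R, hk, Rabs_pos_eq; lra).
    rewrite Cmod_mult, Cmod_pow, hmod.
    apply Rmult_le_compat_l; [apply pow_le; lra|].
    apply hE; rewrite hmod; unfold t; lra. }
  assert (small : forall k : C, Cmod k = 1 -> Cmod (t * k)%C < d).
  { intros k hk; rewrite Cmod_mult, Cmod_R, hk, Rabs_pos_eq by lra; unfold t; lra. }
  assert (n1 : Cmod 1%C = 1) by apply Cmod_1.
  assert (n2 : Cmod (- (1))%C = 1) by (rewrite Cmod_opp; apply Cmod_1).
  assert (n3 : Cmod Ci = 1) by apply Cmod_Ci.
  assert (n4 : Cmod (- Ci)%C = 1) by (rewrite Cmod_opp; apply Cmod_Ci).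
  set (v := fun h => Re (F (z + h)%C) + eps * Cmod (z + h)%C ^ 2).
  assert (S : 4 * (Re (F z) + eps * Cmod z ^ 2) + 4 * (eps * t ^ 2) - 4 * (t ^ 3 * M)
    <= v (t * 1)%C + v (t * (- (1)))%C + v (t * Ci)%C + v (t * (- Ci))%C).
  { pose proof (proj1 (Rabs_le_between _ _) (bound _ n1)) as B1.
    pose proof (proj1 (Rabs_le_between _ _) (bound _ n2)) as B2.
    pose proof (proj1 (Rabs_le_between _ _) (bound _ n3)) as B3.
    pose proof (proj1 (Rabs_le_between _ _) (bound _ n4)) as B4.
    unfold v; rewrite !H.
    set (e1 := (_ ^ 3 * E (t * 1))%C) in *; set (e2 := (_ ^ 3 * E (t * - (1)))%C) in *.
    set (e3 := (_ ^ 3 * E (t * Ci))%C) in *; set (e4 := (_ ^ 3 * E (t * - Ci))%C) in *.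
    rewrite !Cmod2_alt.
    destruct (F z) as [f1 f2], z as [z1 z2], c1 as [a1 a2], c2 as [b1 b2].
    destruct e1 as [e1 e1'], e2 as [e2 e2'], e3 as [e3 e3'], e4 as [e4 e4'].
    simpl in *; clear - B1 B2 B3 B4; lra. }
  assert (P : t ^ 3 * M < eps * t ^ 2).
  { assert (0 < t ^ 2 * (eps - t * M)); [|lra].
    apply Rmult_lt_0_compat; [apply pow_lt|]; lra. }
  destruct (Rlt_dec (Re (F z) + eps * Cmod z ^ 2) (v (t * 1)%C)) as [q1|q1].
  { exists (t * 1)%C; auto. }
  destruct (Rlt_dec (Re (F z) + eps * Cmod z ^ 2) (v (t * (- (1)))%C)) as [q2|q2].
  { exists (t * (- (1)))%C; auto. }
  destruct (Rlt_dec (Re (F z) + eps * Cmod z ^ 2) (v (t * Ci)%C)) as [q3|q3].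
  { exists (t * Ci)%C; auto. }
  exists (t * (- Ci))%C; split; auto. fold (v (t * - Ci)%C). lra.
Qed.

(** With [Re (F 0) = M + 2 * eps], the perturbed function [Re F + eps * |z| ^ 2] is still
    larger at [0] than anywhere on the circle, so it has an interior maximum, which
    [four_point_max] excludes. *)
Lemma max_principle (F : C -> C) (r M : R) :
  regular F -> 0 < r < 1 ->
  (forall z, Cmod z = r -> Re (F z) <= M) -> Re (F 0%C) <= M.
Proof.
  intros hF hr hM.
  destruct (Rle_dec (Re (F 0%C)) M) as [|gap]; [assumption|exfalso].
  set (eps := (Re (F 0%C) - M) / 2).
  assert (heps : 0 < eps) by (unfold eps; lra).
  destruct (disk_max (fun z => Re (F z) + eps * Cmod z ^ 2) r) as [z0 [hz0 H]]; auto.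
  - intros z hz e he.
    destruct (hF z hz) as [c1 J].
    destruct (has_jet_continuous F z c1 J (e / 2) ltac:(lra)) as [d [hd Hd]].
    pose proof (Cmod_ge_0 z); unfold in_disk in hz.
    set (m := Rmin (Rmin d 1) (e / (8 * eps))).
    assert (hm : 0 < m).
    { assert (0 < e / (8 * eps)) by (apply Rdiv_lt_0_compat; lra).
      repeat apply Rmin_glb_lt; lra. }
    exists m; split; auto; intros h hh.
    assert (m <= d /\ m <= 1 /\ m <= e / (8 * eps)) as [m1 [m2 m3]].
    { unfold m; pose proof (Rmin_l (Rmin d 1) (e / (8 * eps)));
      pose proof (Rmin_r (Rmin d 1) (e / (8 * eps)));
      pose proof (Rmin_l d 1); pose proof (Rmin_r d 1); lra. }
    specialize (Hd h ltac:(lra)).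
    pose proof (re_le_Cmod (F (z + h)%C - F z)%C) as K.
    assert (K2 : Rabs (Re (F (z + h)%C) - Re (F z)) < e / 2).
    { unfold Cminus in K, Hd; rewrite re_plus, re_opp in K; unfold Rminus; lra. }
    assert (T1 := Cmod_triangle z h).
    assert (T2 := Cmod_triangle (z + h)%C (- h)%C).
    rewrite Cmod_opp in T2; replace (z + h + - h)%C with z in T2 by ring.
    assert (hh2 : Cmod h * (8 * eps) < e).
    { assert (hhh : Cmod h < e / (8 * eps)) by lra.
      apply (Rmult_lt_compat_r (8 * eps)) in hhh; [|lra].
      now replace (e / (8 * eps) * (8 * eps)) with e in hhh by (field; lra). }
    pose proof (Cmod_ge_0 h); pose proof (Cmod_ge_0 (z + h)%C).
    apply Rabs_def2 in K2.
    set (x := Cmod (z + h)%C) in *; set (y := Cmod z) in *; set (k := Cmod h) in *.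
    assert (Q : Rabs (x ^ 2 - y ^ 2) <= 4 * k).
    { apply Rabs_le; split; nra. }
    apply Rabs_le_between in Q.
    apply Rabs_def1; nra.
  - assert (h0 : M + eps < Re (F z0) + eps * Cmod z0 ^ 2).
    { specialize (H 0%C ltac:(rewrite Cmod_0; lra)); simpl in H; rewrite Cmod_0 in H; simpl.
      unfold eps in *; lra. }
    pose proof (Cmod_ge_0 z0).
    assert (hlt : Cmod z0 < r).
    { destruct (Rle_lt_or_eq_dec _ _ hz0) as [|e]; auto.
      specialize (hM z0 e); rewrite e in h0.
      assert (eps * (r * r) <= eps * 1) by (apply Rmult_le_compat_l; nra); lra. }
    destruct (hF z0) as [c1 J]; [unfold in_disk; lra|].
    destruct (four_point_max F z0 c1 eps (r - Cmod z0) J heps ltac:(lra))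
      as [h [hh Hh]].
    specialize (H (z0 + h)%C); simpl in H, Hh.
    assert (Cmod (z0 + h)%C <= r) by (eapply Rle_trans; [apply Cmod_triangle | lra]).
    specialize (H H1); lra.
Qed.

(** * Bounded functions give contractive Toeplitz matrices *)

Lemma Cmod_quadratic_unit (e q0 q1 q2 : C) :
  Cmod e = 1 ->
  Cmod (q0 + q1 * e + q2 * e ^ 2)%C ^ 2 =
    Cmod q0 ^ 2 + Cmod q1 ^ 2 + Cmod q2 ^ 2
    + 2 * Re (e * (q1 * Cconj q0 + q2 * Cconj q1) + e ^ 2 * (q2 * Cconj q0))%C.
Proof.
  intros he.
  assert (hee : (e * Cconj e = 1)%C) by (rewrite <- Cmod2_conj, he; simpl; f_equal; ring).
  set (y := (e * (q1 * Cconj q0 + q2 * Cconj q1) + e ^ 2 * (q2 * Cconj q0))%C).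
  assert (K : ((q0 + q1 * e + q2 * e ^ 2) * Cconj (q0 + q1 * e + q2 * e ^ 2)
    = q0 * Cconj q0 + q1 * Cconj q1 + q2 * Cconj q2 + (y + Cconj y))%C).
  { unfold y; rewrite !Cplus_conj, !Cmult_conj, !Cplus_conj, !Cmult_conj, !Cpow_conj,
      !Cconj_conj.
    ring [hee]. }
  rewrite <- !Cmod2_conj in K.
  apply (f_equal Re) in K; rewrite !re_plus, re_conj, !re_RtoC in K; lra.
Qed.

(** The left side is the real part of the constant term of [(w(z) / e) Q conj(S)] on [|z| = r], where
    [e = z / r], [Q = q0 + q1 e + q2 e^2] and [S = s0 + s1 e + s2 e^2]; the right side is
    that of [(|Q|^2 + |S|^2) / 2].  In the proof [n1, n2] are the coefficients of [e^-1] and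
    [e^-2], [k1] to [k4] those of the positive powers, [m1, m2] come from [|Q|^2] and
    [|S|^2], and [sg] stands for [r ^ 4 * rho z]. *)
Lemma contraction_form (w rho : C -> C) (w1 w2 w3 : C) (r : R) (q0 q1 q2 s0 s1 s2 : C) :
  regular rho ->
  (forall z, in_disk z -> w z = w1 * z + w2 * z ^ 2 + w3 * z ^ 3 + z ^ 4 * rho z)%C ->
  (forall z, in_disk z -> Cmod (w z) <= 1) ->
  0 < r < 1 ->
  Re (w1 * r * (q0 * Cconj s0 + q1 * Cconj s1 + q2 * Cconj s2)
      + w2 * r ^ 2 * (q0 * Cconj s1 + q1 * Cconj s2) + w3 * r ^ 3 * (q0 * Cconj s2))%C
  <= (Cmod q0 ^ 2 + Cmod q1 ^ 2 + Cmod q2 ^ 2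
      + (Cmod s0 ^ 2 + Cmod s1 ^ 2 + Cmod s2 ^ 2)) / 2.
Proof.
  intros hrho hw hb hr.
  set (W1 := (w1 * r)%C); set (W2 := (w2 * r ^ 2)%C); set (W3 := (w3 * r ^ 3)%C).
  set (c0 := Cconj s0); set (c1 := Cconj s1); set (c2 := Cconj s2).
  set (L := (W1 * (q0 * c0 + q1 * c1 + q2 * c2) + W2 * (q0 * c1 + q1 * c2)
             + W3 * (q0 * c2))%C).
  set (n1 := (W1 * (q0 * c1 + q1 * c2) + W2 * (q0 * c2))%C).
  set (n2 := (W1 * (q0 * c2))%C).
  set (k1 := (W1 * (q1 * c0 + q2 * c1) + W2 * (q0 * c0 + q1 * c1 + q2 * c2)
              + W3 * (q0 * c1 + q1 * c2))%C).
  set (k2 := (W1 * (q2 * c0) + W2 * (q1 * c0 + q2 * c1)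
              + W3 * (q0 * c0 + q1 * c1 + q2 * c2))%C).
  set (k3 := (W2 * (q2 * c0) + W3 * (q1 * c0 + q2 * c1))%C).
  set (k4 := (W3 * (q2 * c0))%C).
  set (m1 := (q1 * Cconj q0 + q2 * Cconj q1 + (s1 * c0 + s2 * c1))%C).
  set (m2 := (q2 * Cconj q0 + s2 * c0)%C).
  set (Phi := fun e sg : C => (e * (k1 + Cconj n1 + -1 * m1)
     + e * e * (k2 + Cconj n2 + -1 * m2) + e * e * e * k3 + e * e * e * e * k4
     + sg * (q0 + q1 * e + q2 * (e * e)) * (e * (c2 + c1 * e + c0 * (e * e))))%C).
  assert (hr0 : RtoC r <> 0%C) by (intros e; apply RtoC_inj in e; lra).
  set (F := fun z : C => Phi (z * / RtoC r)%C (RtoC r ^ 4 * rho z)%C).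
  assert (hF : regular F) by (unfold F, Phi; regular).
  assert (h0 : F 0%C = 0%C) by (unfold F, Phi; ring).
  set (B := (Cmod q0 ^ 2 + Cmod q1 ^ 2 + Cmod q2 ^ 2
      + (Cmod s0 ^ 2 + Cmod s1 ^ 2 + Cmod s2 ^ 2)) / 2).
  enough (H : Re (F 0%C) <= B - Re L) by (rewrite h0 in H; change (Re 0%C) with 0 in H; lra).
  apply (max_principle F r); auto.
  intros z hz.
  set (e := (z * / RtoC r)%C).
  assert (he : Cmod e = 1).
  { unfold e; rewrite Cmod_mult, (Cmod_inv _ hr0), Cmod_R, hz.
    rewrite Rabs_pos_eq by lra; field; lra. }
  assert (hz' : z = (RtoC r * e)%C) by (unfold e; field; auto).
  set (sg := (RtoC r ^ 4 * rho z)%C).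
  set (Q := (q0 + q1 * e + q2 * e ^ 2)%C); set (S := (s0 + s1 * e + s2 * e ^ 2)%C).
  set (V := (W1 + W2 * e + W3 * e ^ 2 + e ^ 3 * sg)%C).
  assert (hin : in_disk z) by (unfold in_disk; lra).
  assert (hV : Cmod V <= 1).
  { specialize (hb z hin); rewrite (hw z hin) in hb.
    replace (w1 * z + w2 * z ^ 2 + w3 * z ^ 3 + z ^ 4 * rho z)%C with (e * V)%C in hb.
    - rewrite Cmod_mult, he in hb; lra.
    - unfold V, sg, W1, W2, W3; rewrite hz' at 2 3 4 5; ring. }
  assert (hQ : Cmod Q ^ 2 = _) by exact (Cmod_quadratic_unit e q0 q1 q2 he).
  assert (hS : Cmod S ^ 2 = _) by exact (Cmod_quadratic_unit e s0 s1 s2 he).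
  assert (hX : Re (V * Q * Cconj S)%C <= (Cmod Q ^ 2 + Cmod S ^ 2) / 2).
  { eapply Rle_trans; [apply Rle_abs|].
    eapply Rle_trans; [apply re_le_Cmod|].
    rewrite !Cmod_mult, Cmod_conj.
    pose proof (Cmod_ge_0 Q); pose proof (Cmod_ge_0 S); pose proof (Cmod_ge_0 V).
    assert (0 <= Cmod Q * Cmod S) by (apply Rmult_le_pos; auto).
    assert (Cmod V * (Cmod Q * Cmod S) <= 1 * (Cmod Q * Cmod S))
      by (apply Rmult_le_compat_r; auto).
    pose proof (pow2_ge_0 (Cmod Q - Cmod S)); lra. }
  assert (hee : (e * Cconj e = 1)%C) by (rewrite <- Cmod2_conj, he; simpl; f_equal; ring).
  assert (key : (V * Q * Cconj S = L + Phi e sg + (e * m1 + e ^ 2 * m2)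
     + (n1 * Cconj e - Cconj n1 * e) + (n2 * Cconj e ^ 2 - Cconj n2 * e ^ 2))%C).
  { unfold S; rewrite !Cplus_conj, !Cmult_conj, Cpow_conj; fold c0 c1 c2.
    unfold V, Q, L, Phi, k1, k2, k3, k4.
    set (t1 := Cconj n1); set (t2 := Cconj n2); set (f := Cconj e) in *.
    unfold n1, n2; clearbody t1 t2 f.
    ring [hee]. }
  assert (z1 : Re (n1 * Cconj e - Cconj n1 * e)%C = 0).
  { unfold Cminus; rewrite re_plus, re_opp.
    rewrite <- (re_conj (Cconj n1 * e)%C), Cmult_conj, Cconj_conj; lra. }
  assert (z2 : Re (n2 * Cconj e ^ 2 - Cconj n2 * e ^ 2)%C = 0).
  { unfold Cminus; rewrite re_plus, re_opp.
    rewrite <- (re_conj (Cconj n2 * e ^ 2)%C), Cmult_conj, Cconj_conj, Cpow_conj; lra. }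
  rewrite key, !re_plus, z1, z2 in hX.
  change (F z) with (Phi e sg).
  rewrite hQ, hS in hX; fold c0 c1 in hX.
  assert (hm : Re (e * m1)%C + Re (e ^ 2 * m2)%C
    = Re (e * (q1 * Cconj q0 + q2 * Cconj q1) + e ^ 2 * (q2 * Cconj q0))%C
      + Re (e * (s1 * c0 + s2 * c1) + e ^ 2 * (s2 * c0))%C).
  { rewrite <- !re_plus; f_equal; unfold m1, m2; ring. }
  unfold B; lra.
Qed.

(** Multiplication by [W1 + W2 e + W3 e^2] modulo [e^3] on [q0 + q1 e + q2 e^2], that is,
    a lower triangular Toeplitz matrix. *)
Definition toeplitz_contraction (W1 W2 W3 : C) : Prop :=
  forall q0 q1 q2 : C,
    Cmod (W1 * q0)%C ^ 2 + Cmod (W1 * q1 + W2 * q0)%C ^ 2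
      + Cmod (W1 * q2 + W2 * q1 + W3 * q0)%C ^ 2
    <= Cmod q0 ^ 2 + Cmod q1 ^ 2 + Cmod q2 ^ 2.

(** For a matrix [T], testing [Re <T q, s> <= (|q|^2 + |s|^2) / 2] on [s = T q] gives
    [|T q| <= |q|]. *)
Lemma schwarz_toeplitz (w rho : C -> C) (w1 w2 w3 : C) (r : R) :
  regular rho ->
  (forall z, in_disk z -> w z = w1 * z + w2 * z ^ 2 + w3 * z ^ 3 + z ^ 4 * rho z)%C ->
  (forall z, in_disk z -> Cmod (w z) <= 1) ->
  0 < r < 1 ->
  toeplitz_contraction (w1 * r)%C (w2 * r ^ 2)%C (w3 * r ^ 3)%C.
Proof.
  intros hrho hw hb hr q0 q1 q2.
  set (W1 := (w1 * r)%C); set (W2 := (w2 * r ^ 2)%C); set (W3 := (w3 * r ^ 3)%C).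
  set (s0 := (W1 * q0)%C); set (s1 := (W1 * q1 + W2 * q0)%C).
  set (s2 := (W1 * q2 + W2 * q1 + W3 * q0)%C).
  pose proof (contraction_form w rho w1 w2 w3 r q0 q1 q2 s0 s1 s2 hrho hw hb hr) as K.
  fold W1 W2 W3 in K.
  match type of K with Re ?x <= _ =>
    replace x with (s0 * Cconj s0 + s1 * Cconj s1 + s2 * Cconj s2)%C in K end.
  2:{ set (c0 := Cconj s0); set (c1 := Cconj s1); set (c2 := Cconj s2).
      unfold s0, s1, s2; ring. }
  rewrite <- !Cmod2_conj, !re_plus, !re_RtoC in K; lra.
Qed.

(** * Schur's inequalities *)

Lemma toeplitz_first (W1 W2 W3 : C) :
  toeplitz_contraction W1 W2 W3 -> Cmod W1 <= 1.
Proof.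
  intros T; specialize (T 1%C 0%C 0%C).
  rewrite Cmod_1, Cmod_0, !Cmult_1_r in T.
  match type of T with _ + ?x ^ 2 + ?y ^ 2 <= _ =>
    pose proof (pow2_ge_0 x); pose proof (pow2_ge_0 y) end.
  pose proof (Cmod_ge_0 W1); nra.
Qed.

(** The cross terms of the two squares on the left agree and cancel.  With [a = W1] and
    [b = W2 / D] this completes the square in [|q1|^2 - |W1 q1 + W2|^2], where
    [q1 = conj a * b + p]. *)
Lemma mobius_identity (a b p : C) :
  Cmod (Cconj a * b + p)%C ^ 2 - Cmod (b + a * p)%C ^ 2
  = (1 - Cmod a ^ 2) * (Cmod p ^ 2 - Cmod b ^ 2).
Proof.
  rewrite !Cmod2_alt; destruct a, b, p; simpl; ring.
Qed.

(** The test vector minimizes [|q1|^2 - |W1 q1 + W2|^2]: its middle entry is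
    [conj W1 * W2 / D]. *)
Lemma toeplitz_second (W1 W2 W3 : C) :
  toeplitz_contraction W1 W2 W3 -> Cmod W1 < 1 -> Cmod W2 <= 1 - Cmod W1 ^ 2.
Proof.
  intros T h1.
  pose proof (Cmod_ge_0 W1) as hW1; pose proof (Cmod_ge_0 W2) as hW2.
  set (D := 1 - Cmod W1 ^ 2).
  assert (hD : 0 < D) by (unfold D; nra).
  assert (hD' : RtoC D <> 0%C) by (intros e; apply RtoC_inj in e; lra).
  assert (hc : (W1 * Cconj W1 = 1 - D)%C).
  { rewrite <- Cmod2_conj; unfold D; rewrite RtoC_minus; ring. }
  specialize (T 1%C (Cconj W1 * (W2 / D) + 0)%C 0%C).
  pose proof (mobius_identity W1 (W2 / D)%C 0%C) as I.
  replace (W1 * (Cconj W1 * (W2 / D) + 0) + W2 * 1)%C with (W2 / D + W1 * 0)%C in T.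
  2:{ replace (W1 * (Cconj W1 * (W2 / D) + 0) + W2 * 1)%C
        with (W1 * Cconj W1 * (W2 / D) + W2)%C by ring.
      rewrite hc; field; auto. }
  rewrite Cmult_1_r, Cmod_1, Cmod_0 in T; rewrite Cmod_0 in I.
  match type of T with _ + _ + ?x ^ 2 <= _ => pose proof (pow2_ge_0 x) end.
  rewrite (Cmod_div _ _ hD'), Cmod_R, (Rabs_pos_eq D) in I by lra.
  fold D in I.
  assert (K : D * (Cmod W2 / D) ^ 2 <= D) by (unfold D at 3; lra).
  assert (Cmod W2 / D <= 1).
  { apply Rnot_lt_le; intros c.
    assert (1 < (Cmod W2 / D) ^ 2) by (simpl; nra); nra. }
  apply (Rmult_le_compat_r D) in H0; [|lra].
  replace (Cmod W2 / D * D) with (Cmod W2) in H0 by (field; lra); lra.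
Qed.

(** The test vector is the optimal one.  With [v] the quantity to be bounded and [K] the
    bound, minimizing first over [q2] and then over the deviation [p] of [q1] from
    [conj W1 * W2 / D] gives [p = conj W2 * v / (D K)] and [q2 = conj W1 * v / K]; the
    contraction inequality then reads [|v|^2 / K <= K]. *)
Lemma toeplitz_third (W1 W2 W3 : C) :
  toeplitz_contraction W1 W2 W3 ->
  let D := 1 - Cmod W1 ^ 2 in
  0 < D -> Cmod W2 < D ->
  Cmod (W3 + Cconj W1 * W2 ^ 2 / D)%C <= D - Cmod W2 ^ 2 / D.
Proof.
  intros T D hD h2.
  pose proof (Cmod_ge_0 W1) as hW1; pose proof (Cmod_ge_0 W2) as hW2.
  set (K := D - Cmod W2 ^ 2 / D).
  assert (hDK : D * K = D ^ 2 - Cmod W2 ^ 2) by (unfold K; field; lra).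
  assert (hK : 0 < K).
  { apply Rmult_lt_reg_l with D; auto; rewrite hDK; nra. }
  assert (hD' : RtoC D <> 0%C) by (intros e; apply RtoC_inj in e; lra).
  assert (hK' : RtoC K <> 0%C) by (intros e; apply RtoC_inj in e; lra).
  assert (hc : (W1 * Cconj W1 = 1 - D)%C).
  { rewrite <- Cmod2_conj; unfold D; rewrite RtoC_minus; ring. }
  assert (hc2 : (W2 * Cconj W2 = D ^ 2 - D * K)%C).
  { rewrite <- Cmod2_conj, <- RtoC_mult, <- RtoC_pow, <- RtoC_minus; f_equal; lra. }
  set (v := (W3 + Cconj W1 * W2 ^ 2 / D)%C).
  set (p := (Cconj W2 * v / (D * K))%C).
  specialize (T 1%C (Cconj W1 * (W2 / D) + p)%C (Cconj W1 * v / K)%C).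
  pose proof (mobius_identity W1 (W2 / D)%C p) as I.
  replace (W1 * (Cconj W1 * (W2 / D) + p) + W2 * 1)%C with (W2 / D + W1 * p)%C in T.
  2:{ replace (W1 * (Cconj W1 * (W2 / D) + p) + W2 * 1)%C
        with (W1 * Cconj W1 * (W2 / D) + W1 * p + W2)%C by ring.
      rewrite hc; field; auto. }
  replace (W1 * (Cconj W1 * v / K) + W2 * (Cconj W1 * (W2 / D) + p) + W3 * 1)%C
    with (v / K)%C in T.
  2:{ replace (W1 * (Cconj W1 * v / K) + W2 * (Cconj W1 * (W2 / D) + p) + W3 * 1)%C
        with (W1 * Cconj W1 * v / K + v + W2 * Cconj W2 * v / (D * K))%C
        by (unfold p, v; field; auto).
      rewrite hc, hc2; field; auto. }
  rewrite Cmult_1_r, Cmod_1 in T.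
  assert (hp : Cmod p ^ 2 = Cmod W2 ^ 2 * Cmod v ^ 2 / (D * K) ^ 2).
  { unfold p; rewrite <- RtoC_mult, Cmod_div, Cmod_mult, Cmod_conj, Cmod_R.
    - rewrite Rabs_pos_eq by nra; field; split; lra.
    - intros e; apply RtoC_inj in e; nra. }
  rewrite (Cmod_div v _ hK'), (Cmod_div (Cconj W1 * v)%C _ hK'), Cmod_mult, Cmod_conj,
    Cmod_R, (Rabs_pos_eq K) in T by lra.
  rewrite (Cmod_div _ _ hD'), Cmod_R, (Rabs_pos_eq D), hp in I by lra.
  fold D in I.
  pose proof (Cmod_ge_0 v) as hv.
  assert (E1 : D * (Cmod v / K) ^ 2
    <= D + D * (Cmod W2 ^ 2 * Cmod v ^ 2 / (D * K) ^ 2 - (Cmod W2 / D) ^ 2)).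
  { replace (D * (Cmod v / K) ^ 2)
      with ((Cmod v / K) ^ 2 - (Cmod W1 * Cmod v / K) ^ 2) by (unfold D; field; lra).
    unfold D at 1; lra. }
  assert (E2 : Cmod v ^ 2 / K <= K).
  { replace (Cmod v ^ 2 / K)
      with (D * (Cmod v / K) ^ 2 - D * (Cmod W2 ^ 2 * Cmod v ^ 2 / (D * K) ^ 2)).
    - assert (eK : K = D - D * (Cmod W2 / D) ^ 2) by (unfold K; field; lra); lra.
    - replace (Cmod W2 ^ 2) with (D ^ 2 - D * K) by lra; field; split; lra. }
  apply (Rmult_le_compat_r K) in E2; [|lra].
  replace (Cmod v ^ 2 / K * K) with (Cmod v ^ 2) in E2 by (field; lra).
  nra.
Qed.

(** * The sharp estimate *)

(** With [s = x^2], at [t = 1] the left side is [4 + (2 - alpha) s - (4 + alpha^2) s^2],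
    and the right side is the maximum of this quadratic over all real [s], attained at
    [s = (2 - alpha) / (2 (4 + alpha^2))]. *)
Lemma sharp_estimate (alpha x t : R) :
  0 < alpha <= 1 -> 0 <= x <= 1 -> 0 <= t <= 1 ->
  (1 - x ^ 2) * (6 * x * (1 - t ^ 2) + 6 * x ^ 2 * t ^ 2 + (4 - alpha) * x ^ 2 * t
                 + 4 * (1 - x ^ 2) * t ^ 2) + (2 - alpha - alpha ^ 2) * x ^ 4
  <= 17 / 4 - alpha / (4 + alpha ^ 2).
Proof.
  intros ha hx ht.
  apply Rle_trans with
    (4 + (2 - alpha) * x ^ 2 - (4 + alpha ^ 2) * (x ^ 2) ^ 2).
  - assert (0 <= 1 - x ^ 2) by nra.
    (* The second factor is 6 x + 2 (1 - x) (2 - x) t^2 + (4 - alpha) x^2 t, increasing in t;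
       A1 and A2 are its defects from t = 1, the first one halved. *)
    assert (A1 : 0 <= (1 - t ^ 2) * ((1 - x) * (2 - x))).
    { apply Rmult_le_pos; [nra | apply Rmult_le_pos; lra]. }
    assert (A2 : 0 <= (4 - alpha) * x ^ 2 * (1 - t)).
    { apply Rmult_le_pos; [apply Rmult_le_pos; [lra | nra] | lra]. }
    assert (A3 : 0 <= (1 - x ^ 2)
      * (2 * ((1 - t ^ 2) * ((1 - x) * (2 - x))) + (4 - alpha) * x ^ 2 * (1 - t)))
      by (apply Rmult_le_pos; lra).
    lra.
  - assert (h4 : 0 < 4 + alpha ^ 2) by nra.
    enough (0 <= (4 + alpha ^ 2) * (x ^ 2 - (2 - alpha) / (2 * (4 + alpha ^ 2))) ^ 2).
    { replace ((4 + alpha ^ 2) * (x ^ 2 - (2 - alpha) / (2 * (4 + alpha ^ 2))) ^ 2)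
        with (17 / 4 - alpha / (4 + alpha ^ 2)
              - (4 + (2 - alpha) * x ^ 2 - (4 + alpha ^ 2) * (x ^ 2) ^ 2)) in H
        by (field; lra).
      lra. }
    apply Rmult_le_pos; [lra | apply pow2_ge_0].
Qed.

(** The second Hankel determinant of [f], up to the factor [alpha ^ 2 / 144], in terms of
    the Taylor coefficients of [w]. *)
Definition hankel_form (alpha : R) (w1 w2 w3 : C) : C :=
  (6 * (w1 * w3) + RtoC (4 - alpha) * (w1 ^ 2 * w2) - 4 * w2 ^ 2
   + RtoC (2 - alpha - alpha ^ 2) * w1 ^ 4)%C.

(** Eliminate [W3] in favour of [v = W3 + conj W1 * W2^2 / D] and apply the triangle
    inequality to the resulting five terms. *)
Lemma hankel_form_bound (alpha : R) (W1 W2 W3 : C) :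
  0 < alpha <= 1 ->
  let D := 1 - Cmod W1 ^ 2 in
  0 < D -> Cmod W2 <= D ->
  Cmod (W3 + Cconj W1 * W2 ^ 2 / D)%C <= D - Cmod W2 ^ 2 / D ->
  Cmod (hankel_form alpha W1 W2 W3) <= 17 / 4 - alpha / (4 + alpha ^ 2).
Proof.
  intros ha D hD h2 h3.
  pose proof (Cmod_ge_0 W1) as hx; pose proof (Cmod_ge_0 W2) as hT.
  set (v := (W3 + Cconj W1 * W2 ^ 2 / D)%C) in *.
  assert (hD' : RtoC D <> 0%C) by (intros e; apply RtoC_inj in e; lra).
  assert (hc : (W1 * Cconj W1 = 1 - D)%C).
  { rewrite <- Cmod2_conj; unfold D; rewrite RtoC_minus; ring. }
  assert (E : hankel_form alpha W1 W2 W3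
    = (RtoC 6 * (W1 * v) + RtoC (-6 * (1 - D) / D) * W2 ^ 2
       + RtoC (4 - alpha) * (W1 ^ 2 * W2)
       + RtoC (-4) * W2 ^ 2 + RtoC (2 - alpha - alpha ^ 2) * W1 ^ 4)%C).
  { unfold hankel_form, v.
    replace (RtoC 6 * (W1 * (W3 + Cconj W1 * W2 ^ 2 / D)))%C
      with (RtoC 6 * (W1 * W3) + RtoC 6 * (W1 * Cconj W1) * W2 ^ 2 / D)%C
      by (field; auto).
    rewrite hc, (RtoC_div (-6 * (1 - D)) D), RtoC_mult, (RtoC_minus 1 D) by lra.
    field; auto. }
  rewrite E.
  set (x := Cmod W1) in *; set (T := Cmod W2) in *.
  set (t := T / D).
  assert (hTt : T = D * t) by (unfold t; field; lra).
  assert (ht : 0 <= t <= 1).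
  { split; apply Rmult_le_reg_l with D; lra. }
  assert (hx1 : x <= 1) by (unfold D in hD; nra).
  eapply Rle_trans; [|apply (sharp_estimate alpha x t); lra].
  assert (b1 : Cmod (RtoC 6 * (W1 * v))%C <= 6 * x * (D - T ^ 2 / D)).
  { rewrite !Cmod_mult, Cmod_R, Rabs_pos_eq by lra; fold x.
    rewrite Rmult_assoc; apply Rmult_le_compat_l; [lra|].
    apply Rmult_le_compat_l; auto. }
  assert (b2 : Cmod (RtoC (-6 * (1 - D) / D) * W2 ^ 2)%C = 6 * x ^ 2 * (T ^ 2 / D)).
  { rewrite Cmod_mult, Cmod_R, Cmod_pow; fold T.
    replace (-6 * (1 - D) / D) with (- (6 * x ^ 2 / D))
      by (replace (x ^ 2) with (1 - D) by (unfold D; ring); field; lra).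
    rewrite Rabs_Ropp, Rabs_pos_eq; [field; lra|].
    apply Rmult_le_pos; [nra | apply Rlt_le, Rinv_0_lt_compat; lra]. }
  assert (b3 : Cmod (RtoC (4 - alpha) * (W1 ^ 2 * W2))%C = (4 - alpha) * x ^ 2 * T).
  { rewrite !Cmod_mult, Cmod_R, Cmod_pow, Rabs_pos_eq by lra; fold x T; ring. }
  assert (b4 : Cmod (RtoC (-4) * W2 ^ 2)%C = 4 * T ^ 2).
  { rewrite Cmod_mult, Cmod_R, Cmod_pow, Rabs_left by lra; fold T; ring. }
  assert (b5 : Cmod (RtoC (2 - alpha - alpha ^ 2) * W1 ^ 4)%C
               = (2 - alpha - alpha ^ 2) * x ^ 4).
  { rewrite Cmod_mult, Cmod_R, Cmod_pow, Rabs_pos_eq by nra; reflexivity. }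
  pose proof (Cmod_triangle (RtoC 6 * (W1 * v) + RtoC (-6 * (1 - D) / D) * W2 ^ 2
       + RtoC (4 - alpha) * (W1 ^ 2 * W2) + RtoC (-4) * W2 ^ 2)%C
     (RtoC (2 - alpha - alpha ^ 2) * W1 ^ 4)%C) as P1.
  pose proof (Cmod_triangle (RtoC 6 * (W1 * v) + RtoC (-6 * (1 - D) / D) * W2 ^ 2
       + RtoC (4 - alpha) * (W1 ^ 2 * W2))%C (RtoC (-4) * W2 ^ 2)%C) as P2.
  pose proof (Cmod_triangle (RtoC 6 * (W1 * v) + RtoC (-6 * (1 - D) / D) * W2 ^ 2)%C
       (RtoC (4 - alpha) * (W1 ^ 2 * W2))%C) as P3.
  pose proof (Cmod_triangle (RtoC 6 * (W1 * v))%C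
       (RtoC (-6 * (1 - D) / D) * W2 ^ 2)%C) as P4.
  replace (T ^ 2 / D) with (D * t ^ 2) in * by (rewrite hTt; field; lra).
  rewrite hTt in *; fold D; nra.
Qed.

(** [hankel_form] is homogeneous of degree 4 when [wk] has weight [k], so the bound at
    radius [r] is the bound for [r^4 * |hankel_form alpha w1 w2 w3|]. *)
Lemma hankel_form_schwarz (alpha : R) (w rho : C -> C) (w1 w2 w3 : C) :
  0 < alpha <= 1 ->
  regular rho ->
  (forall z, in_disk z -> w z = w1 * z + w2 * z ^ 2 + w3 * z ^ 3 + z ^ 4 * rho z)%C ->
  (forall z, in_disk z -> Cmod (w z) <= 1) ->
  Cmod (hankel_form alpha w1 w2 w3) <= 17 / 4 - alpha / (4 + alpha ^ 2).
Proof.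
  intros ha hrho hw hb.
  assert (T := fun r => schwarz_toeplitz w rho w1 w2 w3 r hrho hw hb).
  pose proof (Cmod_ge_0 w1) as p1; pose proof (Cmod_ge_0 w2) as p2.
  set (B := 17 / 4 - alpha / (4 + alpha ^ 2)).
  assert (m1 : forall r, 0 < r < 1 -> Cmod (w1 * r)%C = Cmod w1 * r).
  { intros r hr; rewrite Cmod_mult, Cmod_R, Rabs_pos_eq; lra. }
  assert (m2 : forall r, 0 < r < 1 -> Cmod (w2 * r ^ 2)%C = Cmod w2 * r ^ 2).
  { intros r hr; rewrite Cmod_mult, Cmod_pow, Cmod_R, Rabs_pos_eq; lra. }
  (* Strict inequalities at radius r come from the weak ones at a larger radius. *)
  assert (strict1 : forall r, 0 < r < 1 -> Cmod w1 * r < 1).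
  { intros r hr; set (s := (1 + r) / 2).
    assert (hs : 0 < s < 1) by (unfold s; lra).
    pose proof (toeplitz_first _ _ _ (T s hs)) as K; rewrite (m1 s hs) in K.
    assert (r < s) by (unfold s; lra).
    destruct (Req_dec (Cmod w1) 0); nra. }
  assert (strict2 : forall r, 0 < r < 1 -> Cmod w2 * r ^ 2 < 1 - (Cmod w1 * r) ^ 2).
  { intros r hr; set (s := (1 + r) / 2).
    assert (hs : 0 < s < 1) by (unfold s; lra).
    assert (hrs : r < s) by (unfold s; lra).
    pose proof (strict1 s hs) as K1; rewrite <- (m1 s hs) in K1.
    pose proof (toeplitz_second _ _ _ (T s hs) K1) as K.
    rewrite (m1 s hs), (m2 s hs) in K.
    assert (K' : (Cmod w2 + Cmod w1 ^ 2) * s ^ 2 <= 1) by lra.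
    enough ((Cmod w2 + Cmod w1 ^ 2) * r ^ 2 < 1) by lra.
    assert (0 <= Cmod w2 + Cmod w1 ^ 2) by nra.
    destruct (Req_dec (Cmod w2 + Cmod w1 ^ 2) 0) as [e|e]; [rewrite e; lra|].
    assert (r ^ 2 < s ^ 2) by nra. nra. }
  assert (bd : forall r, 0 < r < 1 -> Cmod (hankel_form alpha w1 w2 w3) * r ^ 4 <= B).
  { intros r hr.
    replace (Cmod (hankel_form alpha w1 w2 w3) * r ^ 4)
      with (Cmod (hankel_form alpha (w1 * r) (w2 * r ^ 2) (w3 * r ^ 3))).
    2:{ replace (r ^ 4) with (Cmod (RtoC r ^ 4)%C)
          by (rewrite Cmod_pow, Cmod_R, Rabs_pos_eq; lra).
        rewrite <- Cmod_mult; f_equal; unfold hankel_form; ring. }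
    pose proof (strict1 r hr) as K1; pose proof (strict2 r hr) as K2.
    rewrite <- (m1 r hr) in K1, K2; rewrite <- (m2 r hr) in K2.
    pose proof (Cmod_ge_0 (w2 * r ^ 2)%C).
    apply hankel_form_bound; auto; try lra.
    apply (toeplitz_third _ _ _ (T r hr)); lra. }
  set (X := Cmod (hankel_form alpha w1 w2 w3)) in *.
  assert (hX : 0 <= X) by apply Cmod_ge_0.
  destruct (Rle_dec X B) as [|n]; auto; exfalso.
  (* r is close enough to 1: r^4 >= 1 - 4 (1 - r) *)
  set (d := Rmin (1 / 2) ((X - B) / (8 * (X + 1)))).
  assert (hq : 0 < (X - B) / (8 * (X + 1))) by (apply Rdiv_lt_0_compat; lra).
  assert (hd : 0 < d) by (apply Rmin_glb_lt; lra).
  assert (hd1 : d <= 1 / 2) by apply Rmin_l.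
  assert (hd2 : d * (8 * (X + 1)) <= X - B).
  { assert (d <= (X - B) / (8 * (X + 1))) by apply Rmin_r.
    apply (Rmult_le_compat_r (8 * (X + 1))) in H; [|lra].
    now replace ((X - B) / (8 * (X + 1)) * (8 * (X + 1))) with (X - B) in H
      by (field; lra). }
  specialize (bd (1 - d) ltac:(lra)).
  assert (b4 : 1 - 4 * d <= (1 - d) ^ 4).
  { assert (1 - 2 * d <= (1 - d) ^ 2) by nra.
    replace ((1 - d) ^ 4) with (((1 - d) ^ 2) ^ 2) by ring.
    assert (0 <= 1 - 2 * d) by lra. nra. }
  nra.
Qed.

(** * The class G(alpha) *)

Lemma Csum_shift (a : nat -> C) (z : C) :
  abs_summable a -> in_disk z ->
  (Csum a z = a 0%nat + z * Csum (fun n => a (S n)) z)%C.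
Proof.
  intros H hz; apply Csum_intro.
  apply is_series_decr_1.
  pose proof (is_series_scal z _ _ (Csum_correct _ z (abs_summable_shift a H) hz)) as K.
  match goal with |- is_series _ ?l =>
    replace l with (scal z (Csum (fun n : nat => a (S n)) z)) end.
  2:{ change (z * Csum (fun n => a (S n)) z
        = a 0%nat + z * Csum (fun n => a (S n)) z + - (1 * a 0%nat))%C; ring. }
  eapply is_series_ext; [|exact K]; intros n.
  change (z * (z ^ n * a (S n)) = z ^ S n * a (S n))%C; simpl; ring.
Qed.

Lemma Csum_regular (a : nat -> C) : abs_summable a -> regular (Csum a).
Proof. intros H z hz; eexists; now apply Csum_has_jet. Qed.

(** The half plane [Re y < alpha / 2] is the set of points closer to [0] than to [alpha]. *)
Lemma Cmod_schwarz_quotient (alpha : R) (y : C) :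
  0 < alpha -> Re y < / 2 * alpha -> y <> RtoC alpha /\ Cmod y <= Cmod (RtoC alpha - y)%C.
Proof.
  intros ha hy; split.
  - intros ->; rewrite re_RtoC in hy; lra.
  - apply Rsqr_incr_0_var; [|apply Cmod_ge_0].
    rewrite !Rsqr_pow2, !Cmod2_alt; destruct y as [y1 y2]; simpl in *; nra.
Qed.

Theorem theorem3 (alpha : R) (f : C -> C) (a : nat -> C)
  (halpha : 0 < alpha <= 1)
  (hf : class_G alpha f)
  (ha : has_expansion f a) :
  Cmod (hankel2_2 a)
    <= alpha ^ 2 / 144 * (17 / 4 - alpha / (4 + alpha ^ 2)).
Proof.
  destruct hf as [[_ [_ hf1]] [hnz hre]].
  assert (sa : abs_summable a) by exact (abs_summable_of_sum a f ha).
  set (b := derive_coeffs a); set (d := derive_coeffs b).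
  assert (sb : abs_summable b) by now apply abs_summable_derive.
  assert (sd : abs_summable d) by now apply abs_summable_derive.
  assert (ef : forall z, in_disk z -> Csum a z = f z)
    by (intros z hz; apply Csum_intro, ha, hz).
  assert (eg : forall z, in_disk z -> C_derive f z = Csum b z).
  { intros z hz; apply has_jet_C_derive, (has_jet_ext_disk (Csum a)); auto.
    now apply Csum_has_jet. }
  assert (ek : forall z, in_disk z -> C_derive (C_derive f) z = Csum d z).
  { intros z hz; apply has_jet_C_derive, (has_jet_ext_disk (Csum b)); auto.
    - intros x hx; symmetry; auto.
    - now apply Csum_has_jet. }
  assert (in0 : in_disk 0%C) by (unfold in_disk; rewrite Cmod_0; lra).
  assert (b0 : b 0%nat = 1%C).
  { rewrite <- hf1, eg, Csum_shift by auto; ring. }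
  set (G4 := Csum (fun n => b (S (S (S (S n)))))).
  set (K3 := Csum (fun n => d (S (S (S n))))).
  assert (rG4 : regular G4)
    by (apply Csum_regular; do 3 apply (abs_summable_shift (fun n => _));
        now apply (abs_summable_shift b)).
  assert (rK3 : regular K3)
    by (apply Csum_regular; do 2 apply (abs_summable_shift (fun n => _));
        now apply (abs_summable_shift d)).
  set (g := fun z => (1 + b 1%nat * z + b 2%nat * (z * z) + b 3%nat * (z * z * z)
                      + z * z * z * z * G4 z)%C).
  set (h := fun z => (d 0%nat * z + d 1%nat * (z * z) + d 2%nat * (z * z * z)
                      + z * z * z * z * K3 z)%C).
  assert (eg' : forall z, in_disk z -> C_derive f z = g z).
  { intros z hz; rewrite eg by auto; unfold g, G4.
    rewrite (Csum_shift b), (Csum_shift (fun n => b (S n))),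
      (Csum_shift (fun n => b (S (S n)))), (Csum_shift (fun n => b (S (S (S n)))));
      auto using abs_summable_shift.
    - rewrite b0; ring.
    - apply (abs_summable_shift (fun n => b (S (S n)))), (abs_summable_shift (fun n => b (S n))),
        (abs_summable_shift b), sb.
    - apply (abs_summable_shift (fun n => b (S n))), (abs_summable_shift b), sb. }
  assert (eh : forall z, in_disk z -> (z * C_derive (C_derive f) z = h z)%C).
  { intros z hz; rewrite ek by auto; unfold h, K3.
    rewrite (Csum_shift d), (Csum_shift (fun n => d (S n))),
      (Csum_shift (fun n => d (S (S n)))); auto using abs_summable_shift.
    - ring.
    - apply (abs_summable_shift (fun n => d (S n))), (abs_summable_shift d), sd. }
  assert (key : forall z, in_disk z ->
    (RtoC alpha * g z - h z)%C <> 0%C /\ Cmod (h z) <= Cmod (RtoC alpha * g z - h z)%C).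
  { intros z hz.
    specialize (hnz z hz); specialize (hre z hz).
    rewrite (eh z hz) in hre; rewrite (eg' z hz) in hnz, hre.
    rewrite re_plus, re_RtoC in hre.
    destruct (Cmod_schwarz_quotient alpha (h z / g z)%C) as [k1 k2]; [lra | lra |].
    replace (RtoC alpha * g z - h z)%C with (g z * (RtoC alpha - h z / g z))%C
      by (field; auto).
    replace (Cmod (h z)) with (Cmod (g z) * Cmod (h z / g z)%C)
      by (rewrite <- Cmod_mult; f_equal; field; auto).
    split.
    - apply Cmult_neq_0; auto; intros e; apply k1.
      replace (h z / g z)%C with (RtoC alpha - (RtoC alpha - h z / g z))%C by ring.
      rewrite e; ring.
    - rewrite Cmod_mult; apply Rmult_le_compat_l; [apply Cmod_ge_0 | exact k2]. }
  (* [e1, e2, e3] are the coefficients of the denominator [alpha g - h] after its constant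
     term [alpha]; [w1, w2, w3] solve the triangular system w * (alpha g - h) = - h, and
     [rho] collects the terms of degree 4 and more of that equation. *)
  assert (hal : RtoC alpha <> 0%C) by (intros e; apply RtoC_inj in e; lra).
  set (e1 := (RtoC alpha * b 1%nat - d 0%nat)%C).
  set (e2 := (RtoC alpha * b 2%nat - d 1%nat)%C).
  set (e3 := (RtoC alpha * b 3%nat - d 2%nat)%C).
  set (w1 := (- d 0%nat / RtoC alpha)%C).
  set (w2 := (- (d 1%nat + w1 * e1) / RtoC alpha)%C).
  set (w3 := (- (d 2%nat + w1 * e2 + w2 * e1) / RtoC alpha)%C).
  set (den := fun z => (RtoC alpha * g z + -1 * h z)%C).
  assert (hden : forall z, in_disk z -> den z <> 0%C).
  { intros z hz; destruct (key z hz) as [k _]; unfold den.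
    now replace (RtoC alpha * g z + -1 * h z)%C with (RtoC alpha * g z - h z)%C by ring. }
  set (rho := fun z => ((-1 * K3 z
      + -1 * ((w1 * z + w2 * (z * z) + w3 * (z * z * z)) * (RtoC alpha * G4 z + -1 * K3 z))
      + -1 * (w1 * e3 + w2 * e2 + w3 * e1 + (w2 * e3 + w3 * e2) * z + w3 * e3 * (z * z)))
      * / den z)%C).
  assert (rden : regular den) by (unfold den, g, h; regular).
  assert (rrho : regular rho).
  { unfold rho; apply regular_mult; [regular | now apply regular_inv]. }
  assert (W := hankel_form_schwarz alpha (fun z => (- h z / den z)%C) rho w1 w2 w3
                 halpha rrho).
  assert (H : hankel2_2 a = (RtoC (alpha ^ 2 / 144) * hankel_form alpha w1 w2 w3)%C).
  { unfold hankel2_2, hankel_form, w3, w2, w1, e2, e1, d, b, derive_coeffs; simpl INR.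
    rewrite !RtoC_div, !RtoC_minus, !RtoC_pow, !RtoC_plus by lra.
    field; auto. }
  rewrite H, Cmod_mult, Cmod_R, Rabs_pos_eq.
  - apply Rmult_le_compat_l; [|apply W].
    + nra.
    + intros z hz; specialize (hden z hz).
      unfold rho.
      transitivity ((- h z) * / den z)%C; [reflexivity|].
      replace (- h z)%C with ((w1 * z + w2 * z ^ 2 + w3 * z ^ 3) * den z
        + z ^ 4 * (-1 * K3 z
      + -1 * ((w1 * z + w2 * (z * z) + w3 * (z * z * z)) * (RtoC alpha * G4 z + -1 * K3 z))
      + -1 * (w1 * e3 + w2 * e2 + w3 * e1 + (w2 * e3 + w3 * e2) * z + w3 * e3 * (z * z))))%C.
      * field; auto.
      * unfold den, g, h, w3, w2, w1, e3, e2, e1; field; auto.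
    + intros z hz; destruct (key z hz) as [k1 k2].
      specialize (hden z hz).
      rewrite Cmod_div, Cmod_opp by auto.
      replace (den z) with (RtoC alpha * g z - h z)%C by (unfold den; ring).
      assert (0 < Cmod (RtoC alpha * g z - h z)%C) by now apply Cmod_gt_0.
      apply Rmult_le_reg_r with (Cmod (RtoC alpha * g z - h z)%C); auto.
      unfold Rdiv; rewrite Rmult_assoc, Rinv_l; lra.
  - nra.
Qed.
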